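(* There is an absolute constant $C>0$ such that the following holds. Let $\mathcal{F}_1,\dots,\mathcal{F}_t$ be set systems with $m_i=|\mathcal{F}_i|>1$ for all $i$, let $\mathcal{F}=\mathcal{F}_1\times\cdots\times\mathcal{F}_t$, and let $D=\prod_{i=1}^t\operatorname{herdisc}\mathcal{F}_i$. Then \[ \frac{D}{C^t\log|\mathcal{F}|\prod_{i=1}^t\sqrt{\log m_i}}\le\operatorname{herdisc}\mathcal{F}\le D\cdot C^t\sqrt{\log|\mathcal{F}|}\prod_{i=1}^t\log m_i . \]
   Context: For set systems $\mathcal{F}$ on $V$ and $\mathcal{G}$ on $W$, the product $\mathcal{F}\times\mathcal{G}=\{F\times G: F\in\mathcal{F},G\in\mathcal{G}\}$ is a set system on $V\times W$; iterated products are defined analogously. For a set system $\mathcal{F}$ on ground set $V$, $\operatorname{disc}\mathcal{F}=\min_{x\in\{-1,1\}^V}\max_{F\in\mathcal{F}}\bigl|\sum_{v\in F}x_v\bigr|$, and $\operatorname{herdisc}\mathcal{F}=\max_{J\subseteq V}\operatorname{disc}(\mathcal{F}|_J)$, where $\mathcal{F}|_J=\{F\cap J:F\in\mathcal{F}\}$. *)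

(* Defs.v *)
From HB Require Import structures.
From mathcomp Require Import all_boot all_order all_algebra.
From mathcomp Require Import all_classical all_reals all_analysis.
Set Implicit Arguments. Unset Strict Implicit. Unset Printing Implicit Defensive.
Import Order.TTheory GRing.Theory Num.Theory.

Definition setsys (V : finType) := {set {set V}}.

Definition csum (V : finType) (x : {ffun V -> bool}) (A : {set V}) : int :=
  (\sum_(v in A) (if x v then 1 else -1))%R.

Definition cmax (V : finType) (F : setsys V) (x : {ffun V -> bool}) : nat :=
  \max_(A in F) absz (csum x A).

Definition disc (V : finType) (F : setsys V) : nat :=
  cmax F [arg min_(x < [ffun=> true]) cmax F x]%O.

Definition restrict (V : finType) (F : setsys V) (J : {set V}) : setsys V :=
  [set A :&: J | A in F].

Definition herdisc (V : finType) (F : setsys V) : nat :=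
  \max_(J : {set V}) disc (restrict F J).

Definition prodT (t : nat) (V : 'I_t -> finType) : finType :=
  {dffun forall i : 'I_t, V i}.

Definition box (t : nat) (V : 'I_t -> finType)
    (S : {dffun forall i : 'I_t, {set V i}}) : {set prodT V} :=
  [set x : prodT V | [forall i, x i \in S i]].

Definition prodsys (t : nat) (V : 'I_t -> finType)
    (F : forall i : 'I_t, setsys (V i)) : setsys (prodT V) :=
  [set A : {set prodT V} |
     [exists S : {dffun forall i : 'I_t, {set V i}},
        [forall i, S i \in F i] && (A == box S)]].

(* Main.v *)
Require Import Defs.
From HB Require Import structures.
From mathcomp Require Import all_boot all_order all_algebra.
From mathcomp Require Import all_classical all_reals all_analysis.
From mathcomp Require Import ring lra zify.
Set Implicit Arguments. Unset Strict Implicit. Unset Printing Implicit Defensive.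
Import Order.TTheory GRing.Theory Num.Theory.
Local Open Scope ring_scope.

(* Both inequalities compare hereditary discrepancy with the factorization norm
   gamma_2 of the incidence matrix (a = <b_i, c_j> with short b_i and c_j).

   Upper bound on discrepancy: the Gram-Schmidt walk signs vectors c_j of norm
   at most 1 so that the signed sum is subgaussian, whence by a union bound
   herdisc <= O(sqrt (log m)) gamma_2.

   Lower bound on discrepancy: a dual certificate of gamma_2 consists of weights
   p, q on rows and columns and a bilinear form T dominated by them.  In the
   p-weighted inner product choose columns greedily by largest residual r_k.
   Binary rounding turns hereditary discrepancy D into the statement that every
   residue vector mod 16 supported on the first k columns has a representative y
   with |a y| <= 16 D; counting these vectors through their triangular
   coordinates gives k r_k^2 <= 128 D^2.  Expanding T in the greedy basis then
   costs only a harmonic sum, so gamma_2 <= O(log m) D.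

   Finally gamma_2 is multiplicative: factorizations multiply entrywise, and
   dual certificates multiply by tensoring. *)

(** The logarithms in the statement record what each comparison with gamma_2 costs. Upper bound: a
    factor log m_i to factorize each incidence matrix, and one sqrt (log |F|) to round the product
    factorization. Lower bound: a factor sqrt (log m_i) to extract a witness from each factor, and
    one log |F| to compare the tensored witness with the product system. The comparisons lose 36 and
    14, the latter weakened to 15 to make an inequality strict, so that C = 36 * 15 = 540 serves
    both sides.

    Dual weights [p] may vanish on some rows, so the weighted inner product is only semidefinite.
    Spans are therefore controlled through norms and Bessel's inequality, and quotients by a zero
    norm take the value 0, which is the right one because the numerators vanish as well. *)

(** * Exponential moments of a centred two-valued variable *)

Section TwoPoint.
Variable R : realType.
Implicit Types x z h n d w f : R.

(** Squaring exp (-x/2) >= 1 - x/2, positive here, gives exp x <= (1 - x/2)^-2; the rest is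
    polynomial. *)
Lemma expR_le_quadratic x : x <= 1 -> expR x <= 1 + x + 2 * x ^+ 2.
Proof.
move=> x1.
have e1 : 1 - x / 2 <= expR (- (x / 2)) by have := expR_ge1Dx (- (x / 2)).
have e0 : expR x * expR (- (x / 2)) ^+ 2 = 1.
  by rewrite expr2 -!expRD (_ : _ + _ = 0) ?expR0//; lra.
have q : (1 - x / 2) ^+ 2 <= expR (- (x / 2)) ^+ 2.
  by rewrite ler_pXn2r// nnegrE; [lra|exact: expR_ge0].
have q1 : expR x * (1 - x / 2) ^+ 2 <= 1 by rewrite -[leRHS]e0 ler_wpM2l// expR_ge0.
have P : 0 <= 1 + x + 2 * x ^+ 2 by nra.
have K : 1 <= (1 - x / 2) ^+ 2 * (1 + x + 2 * x ^+ 2).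
  have -> : (1 - x / 2) ^+ 2 * (1 + x + 2 * x ^+ 2)
     = 1 + x ^+ 2 * ((1 - x) * (5 - 2 * x)) / 4 by field.
  rewrite lerDl divr_ge0// mulr_ge0 ?sqr_ge0// mulr_ge0; lra.
apply: (@le_trans _ _ (expR x * ((1 - x / 2) ^+ 2 * (1 + x + 2 * x ^+ 2)))).
  by rewrite ler_peMr// expR_ge0.
by rewrite mulrA -[leRHS]mul1r ler_wpM2r.
Qed.

(** The linear term stays outside the exponential: averaged over the two values, it becomes a
    multiple of the derivative of [mgf2]. *)
Lemma expR_le_subgaussian x : expR x <= x + expR (2 * x ^+ 2).
Proof.
have [x1|x1] := leP x 1.
  apply: le_trans (expR_le_quadratic x1) _.
  by have := expR_ge1Dx (2 * x ^+ 2); lra.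
have : expR x <= expR (2 * x ^+ 2) by rewrite ler_expR; nra.
lra.
Qed.

(* The moment generating function at h of a centred variable with the two
   values 1 - z and - (1 + z). *)
Definition mgf2 z h : R :=
  (1 + z) / 2 * expR (h * (1 - z)) + (1 - z) / 2 * expR (- h * (1 + z)).

Lemma mgf2N z h : mgf2 (- z) (- h) = mgf2 z h.
Proof. by rewrite /mgf2 !opprK addrC. Qed.

Lemma mgf2_0 z : mgf2 z 0 = 1.
Proof. by rewrite /mgf2 oppr0 !mul0r expR0; lra. Qed.

Lemma mgf2_ge1 z h : -1 <= z <= 1 -> 1 <= mgf2 z h.
Proof.
move=> /andP[z1 z2]; rewrite /mgf2.
have := expR_ge1Dx (h * (1 - z)); have := expR_ge1Dx (- h * (1 + z)).
set A := expR _; set B := expR _; nra.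
Qed.

Lemma mgf2_martingale z h d :
  expR (d * h) * mgf2 (z + d) h =
  (1 + z + d) / 2 * expR (h * (1 - z)) + (1 - z - d) / 2 * expR (- h * (1 + z)).
Proof.
rewrite /mgf2 mulrDr !(mulrCA (expR _)) -!expRD.
have -> : d * h + h * (1 - (z + d)) = h * (1 - z) by ring.
have -> : d * h + - h * (1 + (z + d)) = - h * (1 + z) by ring.
by congr (_ * _ + _ * _); ring.
Qed.

(** The derivative of [mgf2 z] at h has the sign of h and is at most 16 h times [mgf2 z h] for h >=
    0. So a shift against the sign of h costs only the quadratic term 8 n^2, where 8 = 2 * 2^2 comes
    from |1 - z|, |1 + z| <= 2. *)
Lemma mgf2_shift z h n : -1 <= z <= 1 ->
  mgf2 z (h + n) <= mgf2 z h * expR (8 * n ^+ 2 + 16 * Num.max (h * n) 0).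
Proof.
wlog h0 : z h n / 0 <= h.
  move=> H z1; have [h0|h0] := leP 0 h; first exact: H.
  have := H (- z) (- h) (- n).
  rewrite -opprD !mgf2N sqrrN mulrNN; apply; lra.
move=> zz; have [z1 z2] := andP zz.
set A := expR (h * (1 - z)); set B := expR (- h * (1 + z)).
set E := expR (8 * n ^+ 2).
have G1 := mgf2_ge1 h zz.
have GE : mgf2 z h = (1 + z) / 2 * A + (1 - z) / 2 * B by [].
have A0 : 0 < A := expR_gt0 _; have B0 : 0 < B := expR_gt0 _.
have E1 : expR (n * (1 - z)) <= n * (1 - z) + E.
  apply: le_trans (expR_le_subgaussian _) _; rewrite lerD2l ler_expR exprMn.
  have : (1 - z) ^+ 2 <= 4 by nra.
  have := sqr_ge0 n; nra.
have E2 : expR (- n * (1 + z)) <= - n * (1 + z) + E.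
  apply: le_trans (expR_le_subgaussian _) _; rewrite lerD2l ler_expR exprMn sqrrN.
  have : (1 + z) ^+ 2 <= 4 by nra.
  have := sqr_ge0 n; nra.
(* The coefficient of n is the derivative of [mgf2 z] at h. *)
have step : mgf2 z (h + n) <= n * ((1 - z ^+ 2) / 2 * (A - B)) + E * mgf2 z h.
  rewrite {1}/mgf2 opprD !(mulrDl h) !(mulrDl (- h)) !expRD -/A -/B.
  have H1 : (1 + z) / 2 * A * expR (n * (1 - z)) <=
            (1 + z) / 2 * A * (n * (1 - z) + E).
    by apply: ler_wpM2l => //; apply: mulr_ge0; [lra|exact: ltW].
  have H2 : (1 - z) / 2 * B * expR (- n * (1 + z)) <=
            (1 - z) / 2 * B * (- n * (1 + z) + E).
    by apply: ler_wpM2l => //; apply: mulr_ge0; [lra|exact: ltW].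
  rewrite !mulrA in H1 H2 *.
  apply: le_trans (lerD H1 H2) _; rewrite GE le_eqVlt; apply/orP; left; apply/eqP.
  by field.
have AB : 0 <= A - B by rewrite subr_ge0 ler_expR; nra.
have z20 : 0 <= 1 - z ^+ 2 by nra.
have E0 : 1 <= E by rewrite -expR0 ler_expR; have := sqr_ge0 n; lra.
have [hn|hn] := leP (h * n) 0.
  rewrite mulr0 addr0 -/E; apply: le_trans step _.
  rewrite mulrC -[leRHS]add0r mulrC [mgf2 z h * E]mulrC lerD2r.
  have [n0|n0] := leP n 0.
    rewrite mulr_le0_ge0// mulr_ge0//; lra.
  have h00 : h = 0 by apply/eqP; rewrite eq_le h0 andbT; nra.
  by rewrite /A /B h00 oppr0 !mul0r subrr !mulr0.
have n0 : 0 < n by nra.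
have dA : A - 1 <= h * (1 - z) * A.
  have := expR_ge1Dx (- (h * (1 - z))); rewrite expRN -/A => H.
  have : A * (1 + - (h * (1 - z))) <= A * A^-1 by rewrite ler_pM2l.
  rewrite divff ?gt_eqF//; lra.
have dB : 1 - B <= h * (1 + z).
  have := expR_ge1Dx (- h * (1 + z)); rewrite -/B; lra.
have D : (1 - z ^+ 2) / 2 * (A - B) <= 16 * h * mgf2 z h.
  have H1 : (1 - z ^+ 2) / 2 * (A - B) <=
     (1 - z ^+ 2) / 2 * (h * (1 - z) * A + h * (1 + z)).
    by apply: ler_wpM2l; lra.
  apply: le_trans H1 _.
  have H2 : (1 - z) ^+ 2 * ((1 + z) / 2 * A) <= 4 * ((1 + z) / 2 * A).
    apply: ler_wpM2r; first by apply: mulr_ge0; [lra|exact: ltW].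
    nra.
  have H3 : (1 - z ^+ 2) / 2 * (1 + z) <= 1 by nra.
  have H4 : (1 + z) / 2 * A <= mgf2 z h.
    by rewrite GE lerDl; apply: mulr_ge0; [lra|exact: ltW].
  have H5 : (1 - z) ^+ 2 * ((1 + z) / 2 * A) + (1 - z ^+ 2) / 2 * (1 + z)
     <= 16 * mgf2 z h by lra.
  have -> : (1 - z ^+ 2) / 2 * (h * (1 - z) * A + h * (1 + z)) =
    h * ((1 - z) ^+ 2 * ((1 + z) / 2 * A) + (1 - z ^+ 2) / 2 * (1 + z)) by field.
  have -> : 16 * h * mgf2 z h = h * (16 * mgf2 z h) by ring.
  exact: ler_wpM2l.
apply: le_trans step _.
apply: (@le_trans _ _ (mgf2 z h * (16 * (h * n) + E))).
  have : n * ((1 - z ^+ 2) / 2 * (A - B)) <= n * (16 * h * mgf2 z h).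
    by rewrite ler_pM2l.
  lra.
apply: ler_wpM2l; first lra.
rewrite expRD -/E.
have := expR_ge1Dx (16 * (h * n)); set Y := expR _ => HY.
have : E * (1 + 16 * (h * n)) <= E * Y by rewrite ler_wpM2l//; lra.
nra.
Qed.

Lemma mgf2_hoeffding z h : -1 <= z <= 1 -> mgf2 z h <= expR (8 * h ^+ 2).
Proof.
move=> z1; have := mgf2_shift 0 h z1.
by rewrite add0r mgf2_0 mul1r mul0r maxxx mulr0 addr0.
Qed.

(** The difference of quotients equals (n w - h f)^2 / (f w (w + f)). For h n > 0 its sign suffices;
    for h n <= 0 the numerator is at least -4 h n f w, and w + f <= 1 makes the quotient at least -4
    h n. *)
Lemma energy_slack h n w f : 0 < w -> 0 < f -> w + f <= 1 ->
  2 * Num.max (h * n) 0 <=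
  n ^+ 2 / f + h ^+ 2 / w - (h + n) ^+ 2 / (w + f) + 2 * (h * n).
Proof.
move=> w0 f0 wf.
have wf0 : 0 < w + f by lra.
have -> : n ^+ 2 / f + h ^+ 2 / w - (h + n) ^+ 2 / (w + f) =
    (n * w - h * f) ^+ 2 / (f * w * (w + f)).
  by field; rewrite !gt_eqF.
have [hn|hn] := leP (h * n) 0; last first.
  by rewrite lerDr divr_ge0// ?sqr_ge0// !mulr_ge0// ltW.
rewrite mulr0.
suff : - 4 * (h * n) <= (n * w - h * f) ^+ 2 / (f * w * (w + f)) by lra.
rewrite ler_pdivlMr ?mulr_gt0//.
have fw : 0 < f * w by rewrite mulr_gt0.
have hn0 : 0 <= - (h * n) by lra.
have H1 : 0 <= - (h * n) * (f * w) by apply: mulr_ge0 => //; exact: ltW.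
have H2 : - (h * n) * (f * w) * (w + f) <= - (h * n) * (f * w).
  by rewrite -[leRHS]mulr1; apply: ler_wpM2l.
have -> : (n * w - h * f) ^+ 2 =
  (n * w + h * f) ^+ 2 + 4 * (- (h * n) * (f * w)) by ring.
have := sqr_ge0 (n * w + h * f); lra.
Qed.

(** Here w and f are the squared norms of the pivot's old residual and of its orthogonal increment,
    and h, n are their products with a test vector. The term n^2 / f on the right is the energy
    freed when the alive set shrinks. *)
Lemma pivot_change z h n w f : -1 <= z <= 1 -> 0 <= w -> 0 <= f -> w + f <= 1 ->
  (w = 0 -> h = 0) -> (f = 0 -> n = 0) ->
  expR (8 * ((h + n) ^+ 2 / (w + f) - (h + n) ^+ 2)) * mgf2 z (h + n) <=
  expR (8 * (n ^+ 2 / f + h ^+ 2 / w - h ^+ 2)) * mgf2 z h.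
Proof.
move=> zz w0 f0 wf wh fn.
have G1 := mgf2_ge1 h zz.
have [f00|fne] := eqVneq f 0.
  by rewrite f00 (fn f00) !addr0 expr0n/= mul0r add0r.
have fp : 0 < f by rewrite lt_def fne.
have main : 2 * Num.max (h * n) 0 <=
  n ^+ 2 / f + h ^+ 2 / w - (h + n) ^+ 2 / (w + f) + 2 * (h * n).
  have [w00|wne] := eqVneq w 0.
    rewrite w00 (wh w00) !add0r mul0r maxxx expr0n/= mul0r !mulr0; lra.
  by apply: energy_slack => //; rewrite lt_def wne.
apply: le_trans (_ : expR (8 * ((h + n) ^+ 2 / (w + f) - (h + n) ^+ 2)) *
   (mgf2 z h * expR (8 * n ^+ 2 + 16 * Num.max (h * n) 0)) <= _).
  by rewrite ler_wpM2l ?expR_ge0// mgf2_shift.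
rewrite mulrCA [leRHS]mulrC ler_wpM2l//; first lra.
rewrite -expRD ler_expR.
move: main; set m := Num.max _ _; rewrite sqrrD; lra.
Qed.

End TwoPoint.

(** * The semidefinite inner product weighted by [p] *)

Section WeightedDot.
Variables (R : realType) (m : nat) (p : 'I_m -> R).
Implicit Types u v w : 'rV[R]_m.

Definition wdot u v : R := \sum_i p i * u 0 i * v 0 i.

Lemma wdotC u v : wdot u v = wdot v u.
Proof. by apply: eq_bigr => i _; rewrite -!mulrA [u _ _ * _]mulrC. Qed.

Lemma wdotDl u v w : wdot (u + v) w = wdot u w + wdot v w.
Proof.
by rewrite -big_split; apply: eq_bigr => i _ /=; rewrite mxE mulrDr mulrDl.
Qed.

Lemma wdotZl a u v : wdot (a *: u) v = a * wdot u v.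
Proof. by rewrite mulr_sumr; apply: eq_bigr => i _; rewrite mxE; ring. Qed.

Lemma wdotDr u v w : wdot w (u + v) = wdot w u + wdot w v.
Proof. by rewrite !(wdotC w) wdotDl. Qed.

Lemma wdotZr a u v : wdot u (a *: v) = a * wdot u v.
Proof. by rewrite !(wdotC u) wdotZl. Qed.

Lemma wdotNl u v : wdot (- u) v = - wdot u v.
Proof. by rewrite -scaleN1r wdotZl mulN1r. Qed.

Lemma wdotNr u v : wdot u (- v) = - wdot u v.
Proof. by rewrite !(wdotC u) wdotNl. Qed.

Lemma wdotBl u v w : wdot (u - v) w = wdot u w - wdot v w.
Proof. by rewrite wdotDl wdotNl. Qed.

Lemma wdotBr u v w : wdot w (u - v) = wdot w u - wdot w v.
Proof. by rewrite wdotDr wdotNr. Qed.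

Lemma wdot0l u : wdot 0 u = 0.
Proof. by rewrite -(scale0r 0) wdotZl mul0r. Qed.

Lemma wdot_suml (K : Type) (r : seq K) (P : pred K) (F : K -> 'rV[R]_m) u :
  wdot (\sum_(k <- r | P k) F k) u = \sum_(k <- r | P k) wdot (F k) u.
Proof.
elim/big_ind2 : _ => [|x1 x2 y1 y2 e1 e2|//]; first exact: wdot0l.
by rewrite wdotDl e1 e2.
Qed.

Lemma wdot_sumr (K : Type) (r : seq K) (P : pred K) (F : K -> 'rV[R]_m) u :
  wdot u (\sum_(k <- r | P k) F k) = \sum_(k <- r | P k) wdot u (F k).
Proof. by rewrite wdotC wdot_suml; apply: eq_bigr => k _; rewrite wdotC. Qed.

Hypothesis p_ge0 : forall i, 0 <= p i.

Lemma wdot_ge0 u : 0 <= wdot u u.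
Proof. by apply: sumr_ge0 => i _; rewrite -mulrA mulr_ge0// -expr2 sqr_ge0. Qed.

Lemma wdot_CauchySchwarz u v : wdot u v ^+ 2 <= wdot u u * wdot v v.
Proof.
have Q s : 0 <= wdot u u + 2 * s * wdot u v + s ^+ 2 * wdot v v.
  have := wdot_ge0 (u + s *: v).
  rewrite wdotDl !wdotDr !wdotZl !wdotZr (wdotC v u); lra.
have [v0|v0] := eqVneq (wdot v v) 0.
  rewrite v0 mulr0; have [->|uv0] := eqVneq (wdot u v) 0; first by rewrite expr0n.
  (* With <v, v> = 0 the quadratic is affine in s, and at this s it equals -1. *)
  have := Q (- (wdot u u + 1) / (2 * wdot u v)); rewrite v0 mulr0 addr0.
  rewrite (_ : 2 * _ * _ = - (wdot u u + 1)); first lra.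
  by field.
have vp : 0 < wdot v v by rewrite lt_def v0 wdot_ge0.
have := Q (- wdot u v / wdot v v).
rewrite (_ : _ + _ + _ = (wdot u u * wdot v v - wdot u v ^+ 2) / wdot v v).
  by rewrite pmulr_lge0 ?invr_gt0// subr_ge0.
by field.
Qed.

Lemma wdot_eq0 u v : wdot v v = 0 -> wdot u v = 0.
Proof.
move=> v0; have := wdot_CauchySchwarz u v; rewrite v0 mulr0 => uv.
by apply/eqP; rewrite -sqrf_eq0 eq_le uv sqr_ge0.
Qed.

End WeightedDot.

(** * Orthogonal projections and captured energy *)

Section Projection.
Variables (R : realType) (d : nat) (p : 'I_d -> R) (J : finType).
Variable c : J -> 'rV[R]_d.
Hypothesis p_ge0 : forall i, 0 <= p i.
Implicit Types (A B : {set J}) (x v f : 'rV[R]_d).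
Local Notation "''[' u , v ]" := (wdot p u v).

Definition spanned A v := exists u : J -> R, v = \sum_(k in A) u k *: c k.

Lemma spanned_sub A B v : A \subset B -> spanned A v -> spanned B v.
Proof.
move=> AB [u ->]; exists (fun k => if k \in A then u k else 0).
rewrite big_mkcond [RHS]big_mkcond/=; apply: eq_bigr => k _.
case: ifP => kA; first by rewrite (fintype.subsetP AB).
by case: ifP => //; rewrite scale0r.
Qed.

Lemma spannedB A v w : spanned A v -> spanned A w -> spanned A (v - w).
Proof.
move=> [u ->] [u' ->]; exists (fun k => u k - u' k).
by rewrite -sumrB; apply: eq_bigr => k _; rewrite scalerBl.
Qed.

Lemma spanned1 A j : j \in A -> spanned A (c j).
Proof.
move=> jA; exists (fun k => (k == j)%:R).
rewrite (bigD1 j)//= eqxx scale1r big1 ?addr0// => k /andP[_ /negbTE ->].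
by rewrite scale0r.
Qed.

Lemma orth_spanned A x v : (forall j, j \in A -> '[x, c j] = 0) ->
  spanned A v -> '[x, v] = 0.
Proof.
move=> xA [u ->]; rewrite wdot_sumr big1// => k kA.
by rewrite wdotZr xA// mulr0.
Qed.

Lemma proj_exists A x : exists u : J -> R,
  forall j, j \in A -> '[x - \sum_(k in A) u k *: c k, c j] = 0.
Proof.
have [n] := ubnP #|A|; elim: n => // n IHn in A x *.
case: (set_0Vmem A) => [->|[q qA]] An; first by exists (fun=> 0) => j; rewrite inE.
have qB : q \notin (A :\ q)%SET by rewrite finset.setD11.
have IH : forall x, exists u : J -> R, forall j, j \in (A :\ q)%SET ->
    '[x - \sum_(k in (A :\ q)%SET) u k *: c k, c j] = 0.
  by move=> y; apply: IHn; move: An; rewrite (cardsD1 q A) qA.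
rewrite -(finset.setD1K qA); move: (A :\ q)%SET qB IH => B qB IH {qA An IHn}.
have [u Hu] := IH x; have [u' Hu'] := IH (c q).
set w := c q - \sum_(k in B) u' k *: c k in Hu'.
set vB := \sum_(k in B) u k *: c k in Hu.
(* One Gram-Schmidt step: correct the projection onto [B] along the residual [w] of [c q]. If [w]
   has norm 0, then [al] is 0 and <x, w> vanishes by Cauchy-Schwarz. *)
pose al := '[x, w] / '[w, w].
exists (fun k => if k == q then al else u k - al * u' k).
have -> : \sum_(k in q |: B) (if k == q then al else u k - al * u' k) *: c k
        = vB + al *: w.
  rewrite big_setU1//= eqxx.
  rewrite (eq_bigr (fun k => u k *: c k - al *: (u' k *: c k))).
    rewrite sumrB -scaler_sumr /w /vB scalerBr addrC -!addrA.
    by congr (_ + _); rewrite addrC.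
  move=> k kB; rewrite ifN; first by rewrite scalerBl scalerA.
  by apply: contraNneq qB => <-.
have HB j : j \in B -> '[x - (vB + al *: w), c j] = 0.
  by move=> jB; rewrite opprD addrA wdotBl Hu// wdotZl Hu'// mulr0 subr0.
have vw : '[vB, w] = 0.
  by rewrite wdotC; apply: (orth_spanned Hu'); exists u.
have Hw : '[x - (vB + al *: w), w] = 0.
  rewrite wdotBl wdotDl wdotZl vw add0r /al.
  have [w0|w0] := eqVneq ('[w, w]) 0; last by field.
  by rewrite w0 (wdot_eq0 p_ge0 x w0) mulr0 subrr.
move=> j; rewrite in_setU1 => /orP[/eqP ->|]; last exact: HB.
have -> : c q = w + \sum_(k in B) u' k *: c k by rewrite subrK.
by rewrite wdotDr Hw add0r; apply: (orth_spanned HB); exists u'.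
Qed.

Definition projc A x : J -> R := sval (cid (proj_exists A x)).
Definition proj A x := \sum_(k in A) projc A x k *: c k.
Definition energy A x := '[proj A x, proj A x].

Lemma spanned_proj A x : spanned A (proj A x).
Proof. by exists (projc A x). Qed.

Lemma proj_orth1 A x j : j \in A -> '[x - proj A x, c j] = 0.
Proof. by move=> jA; rewrite /proj /projc; case: cid => u /=; apply. Qed.

Lemma proj_orth A x v : spanned A v -> '[x - proj A x, v] = 0.
Proof. by apply: orth_spanned => j; exact: proj_orth1. Qed.

Lemma energy_ge0 A x : 0 <= energy A x.
Proof. exact: wdot_ge0. Qed.

Lemma energy_le A x : energy A x <= '[x, x].
Proof.
have o := proj_orth x (spanned_proj A x).
have := wdot_ge0 p_ge0 (x - proj A x); move: o.
rewrite !wdotBl !wdotBr (wdotC _ (proj A x) x) /energy; lra.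
Qed.

(** The difference of the two projections has squared norm [energy A x - energy B x] and the same
    product with [f] as [x]; Cauchy-Schwarz concludes. *)
Lemma energy_drop A B x f : B \subset A -> spanned A f ->
    (forall j, j \in B -> '[f, c j] = 0) ->
  energy B x + '[x, f] ^+ 2 / '[f, f] <= energy A x.
Proof.
move=> BA fA fB; set D := proj A x - proj B x.
have AB : '[proj A x, proj B x] = energy B x.
  have h1 := proj_orth x (spanned_sub BA (spanned_proj B x)).
  have h2 := proj_orth x (spanned_proj B x).
  by move: h1 h2; rewrite !wdotBl /energy => h1 h2; lra.
have DD : '[D, D] = energy A x - energy B x.
  by rewrite wdotBl !wdotBr AB wdotC AB /energy; lra.
have Df : '[D, f] = '[x, f].
  have h1 := proj_orth x fA.
  have h2 : '[f, proj B x] = 0 := orth_spanned fB (spanned_proj B x).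
  by move: h1; rewrite !wdotBl (wdotC _ (proj B x)) h2; lra.
have DD0 := wdot_ge0 p_ge0 D.
have := wdot_CauchySchwarz p_ge0 D f; rewrite Df => CS.
have [f0|f0] := eqVneq ('[f, f]) 0; first by rewrite f0 invr0 mulr0; lra.
have fp : 0 < '[f, f] by rewrite lt_def f0 wdot_ge0.
have : '[x, f] ^+ 2 / '[f, f] <= '[D, D] by rewrite ler_pdivrMr.
lra.
Qed.

End Projection.

(** * The Gram-Schmidt walk *)

Section MaxStep.
Variables (R : realType) (J : finType).
Implicit Types z u : J -> R.

Definition alive z := [set j | -1 < z j < 1].

Lemma max_step z u q : q \in alive z -> u q != 0 ->
    (forall j, -1 <= z j <= 1) -> (forall j, j \notin alive z -> u j = 0) ->
  exists d, [/\ 0 <= d, forall j, -1 <= z j + d * u j <= 1 &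
    exists2 j, j \in alive z & (fun k => z k + d * u k) j \notin `]-1, 1[%R].
Proof.
move=> qA uq zz us.
(* [b j] is the step at which coordinate j reaches the end of [-1, 1] it moves towards; the least
   one over moving coordinates is taken. *)
pose b j := ((if 0 < u j then 1 else -1) - z j) / u j.
have [j0 uj0 jmin] := @arg_minP _ R J q (fun j => u j != 0) b uq.
have al j : u j != 0 -> j \in alive z.
  by move=> uj; apply: contraNT uj => /us ->.
have b0 j : u j != 0 -> 0 <= b j.
  move=> uj; have := al _ uj; rewrite inE => /andP[z1 z2]; rewrite /b.
  have [u0|u0] := ltP 0 (u j); first by apply: divr_ge0; lra.
  by rewrite -mulrNN -invrN; apply: divr_ge0; lra.
exists (b j0); split; first exact: b0.
  move=> j; have [uj|uj] := eqVneq (u j) 0; first by rewrite uj mulr0 addr0.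
  have := zz j; have h := jmin j uj; have h0 := b0 _ uj0.
  move: h; rewrite {2}/b; have [u0|u0] := ltP 0 (u j).
    rewrite ler_pdivlMr// => h /andP[z1 z2].
    have : 0 <= b j0 * u j by rewrite mulr_ge0// ltW.
    lra.
  have un : u j < 0 by rewrite lt_neqAle uj.
  rewrite ler_ndivlMr// => h /andP[z1 z2].
  have : b j0 * u j <= 0 by rewrite mulr_ge0_le0.
  lra.
exists j0; first exact: al.
rewrite /b mulrAC -mulrA divff// mulr1 in_itv /=.
by case: ifP => _; rewrite addrC subrK ltxx ?andbF.
Qed.

End MaxStep.

Section Walk.
Variables (R : realType) (d : nat) (p : 'I_d -> R) (J K : finType).
Variables (c : J -> 'rV[R]_d) (th : K -> 'rV[R]_d).
Hypothesis p_ge0 : forall i, 0 <= p i.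
Hypothesis c_le1 : forall j, wdot p (c j) (c j) <= 1.
Implicit Types (A B : {set J}) (z x : J -> R) (k : K).
Local Notation "''[' u , v ]" := (wdot p u v).
Local Notation prj := (proj c p_ge0).
Local Notation enr := (energy c p_ge0).

Definition resid A q := c q - prj A (c q).

(** The first two terms are the energy of [th k] on the span of [A] and the pivot. The subtracted
    term is the pivot's share, returned by the factor [mgf2] of [walkP]; 8 is the constant of
    [mgf2_hoeffding]. *)
Definition walkE A q k :=
  8 * (enr A (th k) + '[th k, resid A q] ^+ 2 / '[resid A q, resid A q]
       - '[th k, resid A q] ^+ 2).

(* Potential of the walk with pivot q at position y and other alive vectors A. *)
Definition walkP A q (y : R) k :=
  expR (walkE A q k) * mgf2 y ('[th k, resid A q]).

Lemma resid_orth A q j : j \in A -> '[resid A q, c j] = 0.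
Proof. exact: proj_orth1. Qed.

Lemma resid_le1 A q : '[resid A q, resid A q] <= 1.
Proof.
apply: le_trans (c_le1 q); have := energy_ge0 c p_ge0 A (c q).
have := proj_orth p_ge0 (c q) (spanned_proj c p_ge0 A (c q)).
rewrite /resid !wdotBl !wdotBr (wdotC _ (prj A _) (c q)) /energy; lra.
Qed.

Lemma sqr_le_quot A q k :
  '[th k, resid A q] ^+ 2 <= '[th k, resid A q] ^+ 2 / '[resid A q, resid A q].
Proof.
have [w0|w0] := eqVneq ('[resid A q, resid A q]) 0.
  by rewrite (wdot_eq0 p_ge0 (th k) w0) expr0n/= mul0r.
have wp : 0 < '[resid A q, resid A q] by rewrite lt_def w0 wdot_ge0.
by rewrite ler_pdivlMr// ler_piMr ?sqr_ge0// resid_le1.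
Qed.

Lemma walkE_ge A q k : 8 * enr A (th k) <= walkE A q k.
Proof. by rewrite /walkE; have := sqr_le_quot A q k; lra. Qed.

Lemma walkP_ge A q y k : -1 <= y <= 1 -> expR (8 * enr A (th k)) <= walkP A q y k.
Proof.
move=> yy; rewrite -[leLHS]mulr1 /walkP; apply: ler_pM => //.
- by rewrite ler_expR walkE_ge.
- exact: mgf2_ge1.
Qed.

Lemma walkP_ge1 A q y k : -1 <= y <= 1 -> 1 <= walkP A q y k.
Proof.
move=> yy; apply: le_trans (walkP_ge A q k yy).
by rewrite -expR0 ler_expR mulr_ge0// energy_ge0.
Qed.

(** The pivot's residual gains an increment [f] orthogonal to the old residual and to [B]. The
    energy lost from [A] to [B] is at least <th, f>^2 / <f, f>, which is the allowance in
    [pivot_change]. *)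
Lemma walkP_shrink A B q y k : B \subset A -> -1 <= y <= 1 ->
  walkP B q y k <= walkP A q y k.
Proof.
move=> BA yy; pose f := prj A (c q) - prj B (c q).
have wE : resid B q = resid A q + f by rewrite /resid /f addrA subrK.
have fA : spanned c A f.
  apply: spannedB; first exact: spanned_proj.
  by apply: spanned_sub BA _; exact: spanned_proj.
have fB j : j \in B -> '[f, c j] = 0.
  move=> jB; have -> : f = resid B q - resid A q by rewrite wE addrAC subrr add0r.
  by rewrite wdotBl !resid_orth ?subrr// (fintype.subsetP BA).
have wf : '[resid A q, f] = 0 by exact: proj_orth.
have drop := energy_drop p_ge0 (th k) BA fA fB.
have wwE : '[resid B q, resid B q] = '[resid A q, resid A q] + '[f, f].
  rewrite wE (wdotDl p (resid A q) f) !(wdotDr p (resid A q) f).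
  by rewrite (wdotC p f (resid A q)) wf; ring.
have wl : '[resid A q, resid A q] + '[f, f] <= 1 by rewrite -wwE resid_le1.
have tE : '[th k, resid B q] = '[th k, resid A q] + '[th k, f] by rewrite wE (wdotDr p (resid A q) f).
have := pivot_change (h := '[th k, resid A q]) (n := '[th k, f]) yy
  (wdot_ge0 p_ge0 (resid A q)) (wdot_ge0 p_ge0 f) wl
  (@wdot_eq0 _ _ _ p_ge0 _ _) (@wdot_eq0 _ _ _ p_ge0 _ _).
rewrite -wwE -tE => H.
rewrite /walkP /walkE.
move: drop H.
set eB := enr B (th k); set eA := enr A (th k).
set g := '[th k, f] ^+ 2 / '[f, f].
set hB := _ / '[resid B q, resid B q]; set hA := _ / '[resid A q, resid A q].
set GA := mgf2 _ _; set GB := mgf2 _ _ => drop H.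
have -> : 8 * (eB + hB - '[th k, resid B q] ^+ 2) =
          8 * eB + 8 * (hB - '[th k, resid B q] ^+ 2) by ring.
rewrite expRD -mulrA.
apply: le_trans (ler_wpM2l (expR_ge0 _) H) _.
rewrite mulrA -expRD ler_wpM2r//; last by rewrite ler_expR; lra.
by apply: le_trans ler01 _; exact: mgf2_ge1.
Qed.

(** Hoeffding's bound cancels the subtracted square in [walkE]; what remains is the energy on a
    subspace of the span of [A]. *)
Lemma walkP_newpivot A B q y k : B \subset A -> q \in A -> -1 <= y <= 1 ->
  walkP B q y k <= expR (8 * enr A (th k)).
Proof.
move=> BA qA yy.
have wA : spanned c A (resid B q).
  apply: spannedB; first exact: spanned1.
  by apply: spanned_sub BA _; exact: spanned_proj.
have drop := energy_drop p_ge0 (th k) BA wA (@resid_orth B q).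
rewrite /walkP.
apply: le_trans (ler_wpM2l (expR_ge0 _) (mgf2_hoeffding _ yy)) _.
by rewrite -expRD ler_expR /walkE; lra.
Qed.

(* Along the direction keeping the vector sum parallel to the pivot's residual,
   the potential is affine in the step, so one of the two extreme steps does
   not increase it. *)
Lemma walk_step (ka : K -> R) z q : q \in alive z -> (forall j, -1 <= z j <= 1) ->
  let A := alive z :\ q in
  exists s : R, exists u : J -> R,
    [/\ forall j, -1 <= z j + s * u j <= 1,
        forall j, j \notin alive z -> u j = 0,
        u q = 1 /\ (exists2 j, j \in alive z & z j + s * u j \notin `]-1, 1[%R),
        \sum_j u j *: c j = resid A q &
        \sum_k ka k * (expR (s * '[th k, resid A q]) * walkP A q (z q + s) k)
        <= \sum_k ka k * walkP A q (z q) k].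
Proof.
move=> qz zz A.
pose u j : R := if j == q then 1 else if j \in A then - projc c p_ge0 A (c q) j else 0.
have uq : u q = 1 by rewrite /u eqxx.
have us j : j \notin alive z -> u j = 0.
  rewrite /u; case: eqP => [->|_]; first by rewrite qz.
  by rewrite !inE => /negbTE ->; rewrite andbF.
have uE : \sum_j u j *: c j = resid A q.
  rewrite (bigD1 q)//= uq scale1r /resid; congr (_ + _).
  rewrite /proj [in RHS]big_mkcond/= -sumrN [RHS](bigD1 q)//= {1}/A finset.setD11 oppr0 add0r.
  apply: eq_bigr => j /negbTE jq; rewrite /u jq.
  by case: ifP => _; rewrite ?scaleNr ?scale0r ?oppr0.
pose L := \sum_k ka k * (expR (walkE A q k) * ((expR ('[th k, resid A q] * (1 - z q)) -
      expR (- '[th k, resid A q] * (1 + z q))) / 2)).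
have lin (s : R) : \sum_k ka k * (expR (s * '[th k, resid A q]) * walkP A q (z q + s) k)
  = \sum_k ka k * walkP A q (z q) k + s * L.
  rewrite mulr_sumr -big_split/=; apply: eq_bigr => k _.
  by rewrite /walkP [expR (s * _) * _]mulrCA mgf2_martingale /mgf2; ring.
have un1 : u q != 0 by rewrite uq oner_neq0.
have [s1 [s10 s1z s1j]] := max_step qz un1 zz us.
have um1 : (fun j => - u j) q != 0 by rewrite /= oppr_eq0.
have ums j : j \notin alive z -> - u j = 0 by move=> /us ->; rewrite oppr0.
have [s2 [s20 s2z s2j]] := max_step qz um1 zz ums.
have [L0|L0] := leP L 0.
  exists s1, u; split => //; rewrite lin gerDl; exact: mulr_ge0_le0.
exists (- s2), u; split => //.
- by move=> j; rewrite mulNr -mulrN.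
- by split=> //; case: s2j => j jA /=; rewrite mulrN -mulNr => H; exists j.
- by rewrite lin gerDl mulNr oppr_le0 mulr_ge0// ltW.
Qed.

(** Every step freezes a coordinate, so induction is on the number of alive ones. The weights [ka]
    are arbitrary so that they can absorb the exponential factors of steps already made. *)
Lemma walk_exists n (ka : K -> R) z q : (forall k, 0 <= ka k) ->
    (forall j, -1 <= z j <= 1) -> q \in alive z -> (#|alive z| <= n)%N ->
  exists x : J -> R, (forall j, x j = 1 \/ x j = -1) /\
    \sum_k ka k * expR ('[th k, \sum_j (x j - z j) *: c j]) <=
    \sum_k ka k * walkP (alive z :\ q) q (z q) k.
Proof.
elim: n ka z q => [|n IH] ka z q ka0 zz qz cz.
  by move: cz; rewrite leqn0 cards_eq0 => /eqP z0; move: qz; rewrite z0 inE.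
have [s [u [z1 us [uq [j0 j0z j0s]] uE le1]]] := walk_step ka qz zz.
set A := alive z :\ q in uE le1 *.
pose z' j := z j + s * u j.
have sub : alive z' \subset alive z.
  apply/fintype.subsetP => j jz'; apply: contraLR jz' => jz.
  by move: (jz); rewrite !inE /z' us// mulr0 addr0.
have lt : (#|alive z'| <= n)%N.
  rewrite -ltnS; apply: leq_trans cz; apply: proper_card.
  rewrite properE sub/=; apply/subsetPn; exists j0 => //.
  by move: j0s; rewrite in_itv inE.
pose ka' k := ka k * expR (s * '[th k, resid A q]).
have ka'0 k : 0 <= ka' k by rewrite mulr_ge0// expR_ge0.
have zq : z' q = z q + s by rewrite /z' uq mulr1.
have split_sum (x : J -> R) k :
    ka k * expR ('[th k, \sum_j (x j - z j) *: c j]) =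
    ka' k * expR ('[th k, \sum_j (x j - z' j) *: c j]).
  rewrite /ka' -mulrA -expRD; congr (_ * expR _).
  rewrite -wdotZr -wdotDr -uE scaler_sumr -big_split/=; congr ('[_, _]).
  by apply: eq_bigr => j _; rewrite scalerA -scalerDl /z'; congr (_ *: _); ring.
have bnd (P : K -> R) : (forall k, P k <= walkP A q (z' q) k) ->
    \sum_k ka' k * P k <= \sum_k ka k * walkP A q (z q) k.
  move=> HP; apply: le_trans le1; apply: ler_sum => k _.
  by rewrite /ka' -mulrA ler_wpM2l// ler_wpM2l ?expR_ge0// -zq.
have [e|[q' q'z]] := set_0Vmem (alive z').
  exists z'; split.
    move=> j; have /andP[h1 h2] := z1 j; have : j \notin alive z' by rewrite e inE.
    by rewrite inE negb_and -!leNgt /z' => /orP[h|h]; [right|left]; lra.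
  rewrite (eq_bigr (fun k => ka' k * 1)); last first.
    move=> k _; rewrite split_sum big1 ?(wdotC _ _ 0) ?wdot0l ?expR0//.
    by move=> j _; rewrite subrr scale0r.
  by apply: bnd => k; apply: walkP_ge1; exact: z1.
(* A surviving pivot only sees the alive set shrink. If it froze, the old potential is still at
   least the exponential of the energy on [A], which pays for any new pivot in [A]. *)
have [qz'|qz'] := boolP (q \in alive z').
  have [x [x1 xle]] := IH ka' z' q ka'0 z1 qz' lt.
  exists x; split=> //; rewrite (eq_bigr _ (fun k _ => split_sum x k)).
  apply: le_trans xle _; apply: bnd => k; apply: walkP_shrink; last exact: z1.
  by apply: finset.setSD.
have [x [x1 xle]] := IH ka' z' q' ka'0 z1 q'z lt.
exists x; split=> //; rewrite (eq_bigr _ (fun k _ => split_sum x k)).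
apply: le_trans xle _; apply: bnd => k.
have q'A : q' \in A.
  rewrite in_setD1 (fintype.subsetP sub _ q'z) andbT.
  by apply: contraNneq qz' => <-.
have sA : alive z' :\ q' \subset A.
  apply/fintype.subsetP => j; rewrite !in_setD1 => /andP[_ jz].
  rewrite (fintype.subsetP sub _ jz) andbT.
  by apply: contraNneq qz' => <-.
apply: le_trans (walkP_newpivot _ sA q'A (z1 q')) _.
by apply: walkP_ge; exact: z1.
Qed.

Lemma signed_sum_subgaussian : exists x : J -> R, (forall j, x j = 1 \/ x j = -1) /\
  \sum_k expR ('[th k, \sum_j x j *: c j]) <= \sum_k expR (8 * '[th k, th k]).
Proof.
have [q _|J0] := pickP (fun _ : J => true); last first.
  exists (fun=> 1); split; first by left.
  apply: ler_sum => k _; rewrite ler_expR big_pred0.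
    by rewrite wdotC wdot0l mulr_ge0// wdot_ge0.
  by move=> j; have := J0 j.
have z0 (j : J) : -1 <= (0 : R) <= 1 by rewrite lerN10 ler01.
have qz : q \in alive (fun _ : J => (0 : R)) by rewrite inE ltrN10 ltr01.
have [x [x1 xle]] := walk_exists (fun=> ler01) z0 qz (leqnn _).
exists x; split => //; apply: le_trans (_ : _ <= _).
  apply: le_trans xle; apply: ler_sum => k _; rewrite mul1r.
  by under [in leRHS]eq_bigr do rewrite subr0.
apply: ler_sum => k _; rewrite mul1r.
apply: le_trans (walkP_newpivot k (finset.subsetT _) (finset.in_setT q) (z0 q)) _.
by rewrite ler_expR ler_wpM2l// energy_le.
Qed.

End Walk.

(** * Factorizations and dual witnesses *)

Section Notions.
Variable R : realType.

Definition hdisc_le (I : Type) (J : finType) (a : I -> J -> R) (D : R) :=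
  forall S : {set J}, exists x : J -> R, (forall j, x j = 1 \/ x j = -1) /\
    forall i, `|\sum_(j in S) a i j * x j| <= D.

(* The factorization norm of a is the least such g. *)
Definition factors (I J : Type) (a : I -> J -> R) (g : R) :=
  exists (d : finType) (b : I -> d -> R) (c : J -> d -> R),
    [/\ forall i j, a i j = \sum_k b i k * c j k,
        forall i, \sum_k b i k ^+ 2 <= g &
        forall j, \sum_k c j k ^+ 2 <= g].

Definition bilin (I J : finType) (T : I -> J -> R) (b : I -> R) (c : J -> R) : R :=
  \sum_i \sum_j T i j * b i * c j.

(** The arithmetic-mean form of bilin T b c <= |b|_p |c|_q; rescaling b against c gives back the
    geometric mean. *)
Definition dominated (I J : finType) (p : I -> R) (q : J -> R) (T : I -> J -> R) :=
  forall b c, bilin T b c <= (\sum_i p i * b i ^+ 2 + \sum_j q j * c j ^+ 2) / 2.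

Definition is_prob (I : finType) (p : I -> R) :=
  (forall i, 0 <= p i) /\ \sum_i p i = 1.

(* The lower bound v on the factorization norm certified by SDP duality. *)
Definition witness (I J : finType) (a : I -> J -> R) (v : R) :=
  exists (p : I -> R) (q : J -> R) (T : I -> J -> R),
    [/\ is_prob p, is_prob q, dominated p q T &
        \sum_i \sum_j T i j * a i j = v].

End Notions.

(** * Signing the columns of a factorization *)

Section FactorsDiscrepancy.
Variable R : realType.

Lemma ln_double (m : nat) : (2 <= m)%N -> ln ((2 * m)%:R : R) <= 2 * ln (m%:R : R).
Proof.
move=> m2; have m0 : 0 < (m%:R : R) by rewrite ltr0n; lia.
rewrite natrM lnM ?posrE//.
rewrite (_ : 2 * ln m%:R = ln m%:R + ln m%:R); last by ring.
rewrite lerD2r.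
by rewrite ler_ln ?posrE ?ltr0n ?ler_nat//; lia.
Qed.

Lemma ln2_ge_half : (1 / 2 : R) <= ln 2.
Proof.
rewrite -[leLHS]expRK ler_ln ?posrE// ?expR_gt0//.
have : expR (1 / 2 : R) <= 1 + 1 / 2 + 2 * (1 / 2) ^+ 2.
  by apply: expR_le_quadratic; lra.
lra.
Qed.

Lemma ln_nat_ge_half (m : nat) : (2 <= m)%N -> (1 / 2 : R) <= ln (m%:R : R).
Proof.
move=> m2; apply: le_trans ln2_ge_half _.
by rewrite ler_ln ?posrE// ?ltr0n ?ler_nat//; lia.
Qed.

Lemma ln_nat_gt0 (m : nat) : (2 <= m)%N -> 0 < ln (m%:R : R).
Proof. by move=> /ln_nat_ge_half; lra. Qed.

Lemma factors_hdisc_le (I J : finType) (a : I -> J -> R) (g : R) :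
  0 < g -> (2 <= #|I|)%N -> factors a g ->
  hdisc_le a (14 * Num.sqrt (ln (#|I|%:R : R)) * g).
Proof.
move=> g0 m2 [d [b [c [aE bg cg]]]] S.
have lm := ln_nat_ge_half m2.
set m := #|I| in m2 lm *.
pose L : R := ln ((2 * m)%:R).
have L0 : 0 < L by rewrite ln_gt0// ltr1n; lia.
pose mu := Num.sqrt L; have mu0 : 0 < mu by rewrite sqrtr_gt0.
have mu2 : mu ^+ 2 = L by rewrite sqr_sqrtr// ltW.
pose sg := Num.sqrt g; have sg0 : 0 < sg by rewrite sqrtr_gt0.
have sg2 : sg ^+ 2 = g by rewrite sqr_sqrtr// ltW.
pose ev (k : 'I_#|d|) : d := enum_val k.
(* Zeroing the columns outside [S] makes the bound hereditary. *)
pose cc j : 'rV[R]_#|d| :=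
  if j \in S then \row_k (c j (ev k) / sg) else 0.
(* Both signs of each row occur, to control absolute values. The scale makes every squared norm at
   most L = ln (2m), so the 2m exponentials sum to at most exp (L + 8 L). *)
pose th (i : I * bool) : 'rV[R]_#|d| :=
  \row_k ((-1) ^+ i.2 * (mu / sg) * b i.1 (ev k)).
pose one (i : 'I_#|d|) : R := 1.
have p0 (i : 'I_#|d|) : 0 <= one i by [].
have sumE (f : d -> R) : \sum_(k < #|d|) f (ev k) = \sum_k f k.
  by rewrite -(big_enum_val (A := d))/=; apply: eq_bigl.
have cc1 j : wdot one (cc j) (cc j) <= 1.
  rewrite /cc; case: ifP => _; last by rewrite wdot0l.
  rewrite /wdot (eq_bigr (fun k => (c j (ev k)) ^+ 2 / g)); last first.
    by move=> k _; rewrite !mxE /one mul1r -sg2; field; rewrite gt_eqF.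
  rewrite -mulr_suml (sumE (fun k => c j k ^+ 2)) ler_pdivrMr// mul1r.
  exact: cg.
have [x [x1 xle]] := signed_sum_subgaussian th p0 cc1.
exists x; split=> // i.
set Y := \sum_(j in S) _.
have ipE s : wdot one (th (i, s)) (\sum_j x j *: cc j) = (-1) ^+ s * (mu / g) * Y.
  rewrite wdot_sumr /Y mulr_sumr [RHS]big_mkcond/=; apply: eq_bigr => j _.
  rewrite wdotZr /cc; case: ifP => jS; last by rewrite wdotC wdot0l mulr0.
  rewrite aE -(sumE (fun k => b i k * c j k)) /wdot mulr_suml !mulr_sumr.
  by apply: eq_bigr => k _; rewrite !mxE /one mul1r -sg2; field; rewrite gt_eqF.
have thE (k : I * bool) : wdot one (th k) (th k) <= L.
  case: k => k s.
  rewrite /wdot (eq_bigr (fun l => L / g * b k (ev l) ^+ 2)); last first.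
    move=> l _; rewrite !mxE /one mul1r /= -sg2 -mu2.
    have := sqrr_sign R s; move: ((-1) ^+ s) => e e2.
    rewrite (_ : _ * _ = e ^+ 2 * ((mu / sg) ^+ 2 * b k (ev l) ^+ 2)); last ring.
    by rewrite e2 mul1r expr_div_n.
  rewrite -mulr_sumr (sumE (fun l => b k l ^+ 2)) mulrAC ler_pdivrMr//.
  by rewrite ler_pM2l.
have tot : \sum_k expR (8 * wdot one (th k) (th k)) <= expR (9 * L).
  apply: le_trans (_ : \sum_(k : I * bool) expR (8 * L) <= _).
    by apply: ler_sum => k _; rewrite ler_expR ler_pM2l.
  rewrite sumr_const card_prod card_bool (mulnC #|I|) -/m -[_ *+ (2 * m)]mulr_natr.
  have -> : (2 * m)%:R = expR L :> R.
    by rewrite lnK// posrE ltr0n; lia.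
  by rewrite -expRD ler_expR; lra.
have bnd s : (-1) ^+ (s : bool) * (mu / g) * Y <= 9 * L.
  rewrite -ler_expR -ipE; apply: le_trans tot; apply: le_trans xle.
  rewrite (bigD1 (i, s))//= lerDl sumr_ge0// => k _; exact: expR_ge0.
have YL : mu / g * `|Y| <= 9 * L.
  have := bnd false; have := bnd true; rewrite !expr0 !expr1 mul1r mulN1r.
  by case: (ler0P Y) => _; lra.
have mg : 0 < mu / g by rewrite divr_gt0.
have Y1 : `|Y| <= 9 * mu * g.
  rewrite -(ler_pM2l mg); apply: le_trans YL _; rewrite -mu2.
  by rewrite le_eqVlt; apply/orP; left; apply/eqP; field; rewrite gt_eqF.
apply: le_trans Y1 _; rewrite ler_pM2r//.
set q := Num.sqrt _; have q0 : 0 <= q := sqrtr_ge0 _.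
have q2 : q ^+ 2 = ln m%:R by rewrite sqr_sqrtr//; lra.
(* The constant 14 exceeds 9 sqrt 2. *)
have L2 : mu ^+ 2 <= 2 * q ^+ 2 by rewrite mu2 q2; exact: ln_double.
by clear -mu0 q0 L2; nra.
Qed.

End FactorsDiscrepancy.

(** * Factorizations of entrywise products *)

Section FactorsProduct.
Variable R : realType.

Lemma factors_pullback (I J I' J' : Type) (f : I' -> I) (h : J' -> J)
    (a : I -> J -> R) (g : R) :
  factors a g -> factors (fun i j => a (f i) (h j)) g.
Proof.
move=> [d [b [c [aE bg cg]]]].
by exists d, (fun i => b (f i)), (fun j => c (h j)); split => //.
Qed.

(** Tensoring vectors multiplies their inner products and their squared norms. *)
Lemma factors_mul (I J : Type) (a a' : I -> J -> R) (g g' : R) :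
  factors a g -> factors a' g' -> factors (fun i j => a i j * a' i j) (g * g').
Proof.
move=> [d [b [c [aE bg cg]]]] [d' [b' [c' [aE' bg' cg']]]].
exists (d * d')%type, (fun i k => b i k.1 * b' i k.2), (fun j k => c j k.1 * c' j k.2).
split=> [i j|i|j].
- rewrite aE aE' big_distrlr/= pair_bigA/=; apply: eq_bigr => k _; ring.
- rewrite (eq_bigr (fun k => b i k.1 ^+ 2 * b' i k.2 ^+ 2)); last first.
    by move=> k _; rewrite exprMn.
  rewrite -(pair_bigA _ (fun k l => b i k ^+ 2 * b' i l ^+ 2))/= -big_distrlr/=.
  by apply: ler_pM => //; apply: sumr_ge0 => k _; rewrite sqr_ge0.
- rewrite (eq_bigr (fun k => c j k.1 ^+ 2 * c' j k.2 ^+ 2)); last first.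
    by move=> k _; rewrite exprMn.
  rewrite -(pair_bigA _ (fun k l => c j k ^+ 2 * c' j l ^+ 2))/= -big_distrlr/=.
  by apply: ler_pM => //; apply: sumr_ge0 => k _; rewrite sqr_ge0.
Qed.

Lemma factors_prod (I J : Type) (K : Type) (r : seq K) (a : K -> I -> J -> R)
    (g : K -> R) : (forall s, factors (a s) (g s)) ->
  factors (fun i j => \prod_(s <- r) a s i j) (\prod_(s <- r) g s).
Proof.
move=> ag; elim: r => [|s r IH].
  exists unit, (fun _ _ => 1), (fun _ _ => 1).
  by split=> *; rewrite ?big_nil big_const card_unit /= ?expr1n ?mulr1 addr0.
have [d [b [c [aE bg cg]]]] := factors_mul (ag s) IH.
exists d, b, c; split=> [i j|i|j]; rewrite big_cons; [exact: aE|exact: bg|exact: cg].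
Qed.

End FactorsProduct.

(** * Transport and tensor products of dual witnesses *)

Section WitnessTensor.
Variable R : realType.

Lemma sum_pair (A B : finType) (F : A * B -> R) :
  \sum_k F k = \sum_i \sum_j F (i, j).
Proof. by rewrite pair_bigA/=; apply: eq_bigr => -[]. Qed.

Lemma push_sum (I I' : finType) (f : I -> I') (p : I -> R) (F : I' -> R) :
  \sum_i' (\sum_(i | f i == i') p i) * F i' = \sum_i p i * F (f i).
Proof.
rewrite (partition_big f xpredT)//=; apply: eq_bigr => i' _.
by rewrite mulr_suml; apply: eq_bigr => i /eqP ->.
Qed.

Lemma is_prob_push (I I' : finType) (f : I -> I') (p : I -> R) :
  is_prob p -> is_prob (fun i' => \sum_(i | f i == i') p i).
Proof.
move=> [p0 p1]; split; first by move=> i'; apply: sumr_ge0.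
have := push_sum f p (fun=> 1).
by under eq_bigr do rewrite mulr1; under [RHS]eq_bigr do rewrite mulr1; move=> ->.
Qed.

Lemma push_sum2 (I J I' J' : finType) (f : I -> I') (h : J -> J')
    (T : I -> J -> R) (F : I' -> J' -> R) :
  \sum_i' \sum_j' (\sum_(i | f i == i') \sum_(j | h j == j') T i j) * F i' j' =
  \sum_i \sum_j T i j * F (f i) (h j).
Proof.
rewrite [RHS](partition_big f xpredT)//=; apply: eq_bigr => i' _.
under eq_bigr do rewrite mulr_suml.
rewrite exchange_big/=; apply: eq_bigr => i /eqP ->.
exact: push_sum.
Qed.

(** Summing weights over fibres turns every pairing into the original one composed with [f] and [h].
    Fibres may be large, as when several tuples of sets give the same box. *)
Lemma witness_push (I J I' J' : finType) (f : I -> I') (h : J -> J')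
    (a : I -> J -> R) (a' : I' -> J' -> R) (v : R) :
  (forall i j, a i j = a' (f i) (h j)) -> witness a v -> witness a' v.
Proof.
move=> aa' [p [q [T [pp qp dom val]]]].
exists (fun i' => \sum_(i | f i == i') p i), (fun j' => \sum_(j | h j == j') q j),
  (fun i' j' => \sum_(i | f i == i') \sum_(j | h j == j') T i j).
split; [exact: is_prob_push|exact: is_prob_push| |].
  move=> b c; rewrite !push_sum; apply: le_trans (dom (b \o f) (c \o h)).
  rewrite /bilin; under eq_bigr do under eq_bigr do rewrite -mulrA.
  rewrite (push_sum2 f h T (fun i' j' => b i' * c j')).
  by under eq_bigr do under eq_bigr do rewrite mulrA.
rewrite push_sum2 -val; apply: eq_bigr => i _; apply: eq_bigr => j _.
by rewrite aa'.
Qed.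

(** Otherwise a large value of b at the weightless row raises the left side of [dominated] at no
    cost; the value [u] raises it to Q + 1. *)
Lemma dominated_row0 (I J : finType) (p : I -> R) (q : J -> R) (T : I -> J -> R)
    (i : I) (c : J -> R) :
  dominated p q T -> p i = 0 -> \sum_j T i j * c j = 0.
Proof.
move=> dom pi0; apply/eqP; apply: contraT => s0.
set s := \sum_j _ in s0; pose Q := \sum_j q j * c j ^+ 2.
pose u := (Q + 1) / s.
have := dom (fun k => if k == i then u else 0) c.
rewrite /bilin (bigD1 i)//= eqxx [X in _ + X]big1; last first.
  by move=> k /negbTE ki; rewrite big1// => j _; rewrite ki mulr0 mul0r.
rewrite [X in (X + _) / 2](bigD1 i)//= eqxx pi0 mul0r [X in (0 + X + _) / 2]big1; last first.
  by move=> k /negbTE ->; rewrite expr0n mulr0.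
rewrite -/Q !addr0 add0r.
have -> : \sum_j T i j * u * c j = Q + 1.
  under eq_bigr do rewrite mulrAC.
  by rewrite -mulr_suml -/s mulrC /u divfK.
move=> H; have := dom (fun=> 0) c; rewrite /bilin big1; last first.
  by move=> k _; rewrite big1// => j _; rewrite mulr0 mul0r.
rewrite big1 ?add0r -/Q; last by move=> k _; rewrite expr0n mulr0.
lra.
Qed.

(** Divided by [p'], the form T' is a contraction from L2(q') to L2(p'). Apply it to c in the second
    coordinate, then use the domination of T on each fibre over i'. *)
Lemma witness_tensor (I J I' J' : finType) (a : I -> J -> R) (a' : I' -> J' -> R)
    (v v' : R) : witness a v -> witness a' v' ->
  witness (fun (i : I * I') (j : J * J') => a i.1 j.1 * a' i.2 j.2) (v * v').
Proof.
move=> [p [q [T [pp qp dom val]]]] [p' [q' [T' [pp' qp' dom' val']]]].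
have prob2 (A B : finType) (x : A -> R) (y : B -> R) : is_prob x -> is_prob y ->
    is_prob (fun k : A * B => x k.1 * y k.2).
  move=> [x0 x1] [y0 y1]; split; first by move=> k; rewrite mulr_ge0.
  by rewrite sum_pair/= -big_distrlr/= x1 y1 mulr1.
exists (fun k => p k.1 * p' k.2), (fun k => q k.1 * q' k.2),
  (fun i j => T i.1 j.1 * T' i.2 j.2); split; [exact: prob2|exact: prob2| |].
  move=> b c.
  pose Tc j i' := (\sum_j' T' i' j' * c (j, j')) / p' i'.
  have TcE j i' : p' i' * Tc j i' = \sum_j' T' i' j' * c (j, j').
    have [p0|p0] := eqVneq (p' i') 0; last by rewrite /Tc mulrC divfK.
    by rewrite p0 mul0r (dominated_row0 _ dom' p0).
  have contr j : \sum_i' p' i' * Tc j i' ^+ 2 <= \sum_j' q' j' * c (j, j') ^+ 2.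
    (* Testing [dom'] on [Tc j] itself yields X <= (X + Y) / 2, hence X <= Y. *)
    have := dom' (Tc j) (fun j' => c (j, j')).
    have -> : bilin T' (Tc j) (fun j' => c (j, j')) = \sum_i' p' i' * Tc j i' ^+ 2.
      apply: eq_bigr => i' _; rewrite expr2 mulrA TcE mulr_suml.
      by apply: eq_bigr => j' _; rewrite mulrAC.
    lra.
  have -> : bilin (fun i j => T i.1 j.1 * T' i.2 j.2) b c =
      \sum_i' p' i' * bilin T (fun i => b (i, i')) (fun j => Tc j i').
    rewrite /bilin sum_pair exchange_big/=.
    apply: eq_bigr => i' _; rewrite mulr_sumr; apply: eq_bigr => i _.
    rewrite mulr_sumr sum_pair/=; apply: eq_bigr => j _.
    rewrite (_ : p' i' * _ = T i j * b (i, i') * (p' i' * Tc j i')); last ring.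
    by rewrite TcE mulr_sumr; apply: eq_bigr => j' _; ring.
  apply: le_trans (_ : \sum_i' p' i' * ((\sum_i p i * b (i, i') ^+ 2 +
      \sum_j q j * Tc j i' ^+ 2) / 2) <= _).
    by apply: ler_sum => i' _; apply: ler_wpM2l (dom _ _); case: pp'.
  under eq_bigr do rewrite mulrA; rewrite -mulr_suml ler_pM2r ?invr_gt0//.
  under eq_bigr do rewrite mulrDr; rewrite big_split/=; apply: lerD.
    rewrite sum_pair exchange_big/= le_eqVlt; apply/orP; left; apply/eqP.
    by apply: eq_bigr => i' _; rewrite mulr_sumr; apply: eq_bigr => i _; ring.
  rewrite sum_pair/=.
  under eq_bigr do rewrite mulr_sumr; rewrite exchange_big/=.
  apply: ler_sum => j _.
  under eq_bigr do rewrite mulrCA; rewrite -mulr_sumr.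
  under [leRHS]eq_bigr do rewrite -mulrA; rewrite -mulr_sumr.
  by apply: ler_wpM2l (contr j); case: qp.
rewrite sum_pair/= -val -val' big_distrlr/=.
apply: eq_bigr => i _; apply: eq_bigr => i' _.
rewrite sum_pair big_distrlr/=; apply: eq_bigr => j _; apply: eq_bigr => j' _; ring.
Qed.

Lemma witness_one (I J : finType) (x0 : I) (y0 : J) :
  witness (fun (_ : I) (_ : J) => 1 : R) 1.
Proof.
have prob1 (A : finType) (x : A) : is_prob (fun k => (k == x)%:R : R).
  split; first by move=> k; rewrite ler0n.
  by rewrite (bigD1 x)//= eqxx big1 ?addr0// => k /negbTE ->.
have pick1 (A : finType) (x : A) (F : A -> R) : \sum_k (k == x)%:R * F k = F x.
  by rewrite (bigD1 x)//= eqxx mul1r big1 ?addr0// => k /negbTE ->; rewrite mul0r.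
exists (fun i => (i == x0)%:R), (fun j => (j == y0)%:R),
  (fun i j => (i == x0)%:R * (j == y0)%:R); split=> //.
  move=> b c; rewrite !pick1.
  have -> : bilin (fun i j => (i == x0)%:R * (j == y0)%:R) b c = b x0 * c y0.
    rewrite /bilin (eq_bigr (fun i => (i == x0)%:R * (b i * c y0))) ?pick1//.
    move=> i _; rewrite -(pick1 _ y0 (fun j => c j)) !mulr_sumr.
    by apply: eq_bigr => j _; ring.
  have := sqr_ge0 (b x0 - c y0); rewrite sqrrB; lra.
rewrite (eq_bigr (fun i => (i == x0)%:R * 1)) ?pick1// => i _.
rewrite -[X in _ = _ * X](pick1 _ y0 (fun=> 1)) mulr_sumr.
by apply: eq_bigr => j _; ring.
Qed.

(** Induction on the coordinates listed in [r]: a new value at s and a tuple are merged by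
    overwriting the tuple at s, which leaves the other factors alone because s is not in the
    tail. *)
Lemma witness_prod (t : nat) (I J : 'I_t -> finType)
    (a : forall s, I s -> J s -> R) (v : 'I_t -> R) (r : seq 'I_t)
    (x0 : {dffun forall s, I s}) (y0 : {dffun forall s, J s}) :
  (forall s, witness (a s) (v s)) -> uniq r ->
  witness (fun (x : {dffun forall s, I s}) (y : {dffun forall s, J s}) =>
    \prod_(s <- r) a s (x s) (y s)) (\prod_(s <- r) v s).
Proof.
move=> av; elim: r => [_|s r IH /= /andP[sr ur]].
  rewrite big_nil.
  apply: (@witness_push _ _ _ _ id id (fun _ _ => 1)); last exact: witness_one.
  by move=> i j; rewrite big_nil.
rewrite big_cons.
pose upd (K : 'I_t -> finType) (k : K s * {dffun forall s, K s}) :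
    {dffun forall s, K s} := finfun (@eqtype.dfwith _ _ k.2 s k.1).
apply: (witness_push (f := @upd I) (h := @upd J)) (witness_tensor (av s) (IH ur)).
move=> i j; rewrite big_cons !ffunE !dfwith_in; congr (_ * _).
apply: eq_big_seq => k kr; rewrite !ffunE !dfwith_out//.
all: by apply: contraNneq sr => ->.
Qed.

End WitnessTensor.

(** * Greedy columns and lower bounds on discrepancy *)

Section Rounding.
Variable R : realType.

(** Colouring the odd coordinates and adding the colours makes z even; halve and recurse. The error
    doubles and gains D, and 2 (2^L - 1) + 1 = 2^(L+1) - 1. *)
Lemma round_residues (I : Type) (J : finType) (a : I -> J -> R) (D : R) :
  0 <= D -> hdisc_le a D -> forall (L : nat) (z : J -> int),
  exists y w : J -> int, [/\ forall j, z j = y j + (2 ^ L)%:Z * w j,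
    forall j, z j = 0 -> y j = 0 &
    forall i, `|\sum_j a i j * (y j)%:~R| <= (2 ^ L - 1)%:R * D].
Proof.
move=> D0 aD; elim=> [|L IH] z.
  exists (fun=> 0), z; split => // [j|i]; first by rewrite add0r expn0 mul1r.
  by rewrite big1 ?normr0 ?mulr_ge0// => j _; rewrite mulr0.
pose S := [set j | (z j %% 2)%Z == 1].
have [x [x1 xle]] := aD S.
pose e j : int := if j \in S then (if x j == 1 then 1 else -1) else 0.
pose z' j : int := (z j %/ 2)%Z + ((j \in S) && (x j == 1))%:Z.
have zE j : z j + e j = 2 * z' j.
  rewrite [in LHS](divz_eq (z j) 2) /e /z'.
  case: ifPn => jS /=; last first.
    rewrite !addr0; have : (z j %% 2)%Z = 0.
      move: jS; rewrite inE; have := modz_ge0 (z j) (isT : 2 != 0 :> int).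
      have := @ltz_pmod (z j) 2 isT; set u := (_ %% _)%Z; lia.
    by move=> ->; rewrite addr0 mulrC.
  by move: jS; rewrite inE => /eqP ->; case: eqP => _; lia.
have eR j : (e j)%:~R = if j \in S then x j else 0.
  rewrite /e; case: ifP => // _; have [->|xn] := eqVneq (x j) 1; first by [].
  by case: (x1 j) => h; rewrite h ?eqxx in xn *.
have [y' [w [yw y0 yle]]] := IH z'.
exists (fun j => 2 * y' j - e j), w; split.
- move=> j; have := zE j; rewrite yw expnS PoszM; lia.
- move=> j zj; have jS : j \notin S by rewrite inE zj.
  have := zE j; rewrite zj /e (negbTE jS) addr0 => h.
  by rewrite y0 ?mulr0 ?subr0//; lia.
move=> i; have -> : \sum_j a i j * (2 * y' j - e j)%:~R =
    2 * (\sum_j a i j * (y' j)%:~R) - \sum_(j in S) a i j * x j.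
  rewrite mulr_sumr [X in _ - X]big_mkcond -sumrB; apply: eq_bigr => j _.
  rewrite intrB intrM eR; case: ifP => _; ring.
apply: le_trans (ler_normB _ _) _; rewrite normrM ger0_norm//.
have := yle i; have := xle i.
have -> : (2 ^ L.+1 - 1)%:R = 2 * (2 ^ L - 1)%:R + 1 :> R.
  rewrite -natrM natr1; congr (_%:R); rewrite expnS.
  have := expn_gt0 2 L; lia.
set u := `|_|; set u' := `|_|; lra.
Qed.

End Rounding.

(** * Counting integer vectors with small triangular coordinates *)

Section LatticeCount.
Variable R : realType.

Lemma bin_le_exp2 n k : ('C(n, k) <= 2 ^ n)%N.
Proof.
elim: n k => [|n IH] [|k]; rewrite ?bin0 ?expn_gt0//.
by rewrite binS expnS mul2n -addnn leq_add.
Qed.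

Variables (k : nat) (cf : 'I_k -> 'I_k -> R).

Definition tri (y : 'I_k -> int) (l : 'I_k) : R :=
  (y l)%:~R + \sum_(i < k | (l < i)%N) cf l i * (y i)%:~R.

(** Back substitution from the last index: once later entries agree, the two coordinates differ by
    an integer, and equal integer parts and signs make that integer smaller than 1 in absolute
    value. *)
Lemma tri_code_inj (y y' : 'I_k -> int) :
  (forall l, Num.truncn `|tri y l| = Num.truncn `|tri y' l|) ->
  (forall l, (0 <= tri y l) = (0 <= tri y' l)) -> y =1 y'.
Proof.
move=> tr sg l; have [n] := ubnP (k - l); elim: n l => // n IH l ln.
have tail : \sum_(i < k | (l < i)%N) cf l i * (y i)%:~R =
            \sum_(i < k | (l < i)%N) cf l i * (y' i)%:~R.
  apply: eq_bigr => i li; rewrite IH//.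
  have := ltn_ord i; have := ltn_ord l; move: ln li; lia.
have dE : tri y l - tri y' l = (y l - y' l)%:~R.
  by rewrite /tri tail intrB; ring.
have /andP[h1 h2] := truncn_itv (normr_ge0 (tri y l)).
have /andP[h3 h4] := truncn_itv (normr_ge0 (tri y' l)).
rewrite tr in h1 h2.
have lt1 : `|tri y l - tri y' l| < 1.
  have := sg l; move: h1 h2 h3 h4; rewrite -natr1.
  set N := (Num.truncn _)%:R.
  case: (ler0P (tri y l)) => s1; case: (ler0P (tri y' l)) => s2.
  - by move=> *; rewrite ltr_norml; lra.
  - move=> h1 h2 h3 h4 ss; have s3 : 0 <= tri y l by rewrite ss ltW.
    rewrite ltr_norml; lra.
  - move=> h1 h2 h3 h4 ss; have s3 : 0 <= tri y' l by rewrite -ss ltW.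
    rewrite ltr_norml; lra.
  - by move=> *; rewrite ltr_norml; lra.
move: lt1; rewrite dE -intr_norm (ltrz1 R) => h; lia.
Qed.

(* A lattice vector is recovered from the integer parts and signs of its
   triangular coordinates, so few lattice vectors have small coordinates. *)
Lemma residues_tri_bound (B : R) :
  (forall Z : {ffun 'I_k -> 'I_16}, exists y w : 'I_k -> int,
     (forall l, (Z l : nat)%:Z = y l + 16 * w l) /\ \sum_l tri y l ^+ 2 <= B) ->
  (2 * k)%:R <= B.
Proof.
move=> H.
have /choice[y yP] : forall Z : {ffun 'I_k -> 'I_16}, exists y : 'I_k -> int,
    exists w : 'I_k -> int,
    (forall l, (Z l : nat)%:Z = y l + 16 * w l) /\ \sum_l tri y l ^+ 2 <= B by [].
pose M := Num.truncn B.
pose nn Z l := Num.truncn `|tri (y Z) l|.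
have B0 : 0 <= B.
  have [w [_ h]] := yP [ffun=> ord0].
  by apply: le_trans h; apply: sumr_ge0 => l _; rewrite sqr_ge0.
(* A natural number is at most its square, so the bound on squares also bounds the sum of integer
   parts. *)
have sumM Z : (\sum_l nn Z l <= M)%N.
  have [w [_ h]] := yP Z.
  rewrite /M truncn_ge_nat// natr_sum; apply: le_trans h; apply: ler_sum => l _.
  have /andP[h1 _] := truncn_itv (normr_ge0 (tri (y Z) l)).
  apply: (@le_trans _ _ ((nn Z l)%:R ^+ 2)).
    rewrite -natrX ler_nat; case: (nn Z l) => // n; rewrite expnS leq_pmulr//.
  by rewrite -[leRHS]real_normK ?num_real// ler_pXn2r// nnegrE.
have leM Z l : (nn Z l <= M)%N.
  by apply: leq_trans (sumM Z); rewrite (bigD1 l)//= leq_addr.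
pose code Z : k.-tuple 'I_M.+1 * {ffun 'I_k -> bool} :=
  ([tuple inord (nn Z l) | l < k], [ffun l => 0 <= tri (y Z) l]).
have code_inj : injective code.
  move=> Z Z' e; have /= e1 := congr1 fst e; have /= /ffunP e2 := congr1 snd e.
  have yy : y Z =1 y Z'.
    apply: tri_code_inj => l; last by have := e2 l; rewrite !ffunE.
    have := congr1 (fun t : k.-tuple 'I_M.+1 => (tnth t l : nat)) e1.
    by rewrite /= !tnth_mktuple !inordK// ltnS leM.
  apply/ffunP => l; apply/val_inj.
  have [w [hw _]] := yP Z; have [w' [hw' _]] := yP Z'.
  have := hw l; have := hw' l; rewrite yy.
  have := ltn_ord (Z l); have := ltn_ord (Z' l); rewrite /=; lia.
(* Tuples of integer parts with sum at most M are counted by a binomial coefficient of k + M, and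
   signs contribute 2^k. Comparing exponents, 4k <= 2k + M. *)
have : (16 ^ k <= 2 ^ (k + M) * 2 ^ k)%N.
  have -> : (16 ^ k)%N = #|{ffun 'I_k -> 'I_16}| by rewrite card_ffun !card_ord.
  rewrite -(card_imset _ code_inj).
  pose P := [set t : k.-tuple 'I_M.+1 | (\sum_(i <- t) i <= M)%N].
  apply: (@leq_trans #|finset.setX P [set: {ffun 'I_k -> bool}]|).
    apply: subset_leq_card; apply/fintype.subsetP => _ /imsetP[Z _ ->].
    rewrite inE /= !inE andbT big_tuple.
    apply: leq_trans (sumM Z); apply: leq_sum => l _.
    by rewrite tnth_mktuple inordK// ltnS leM.
  rewrite cardsX card_partial_ord_partitions cardsT card_ffun card_bool card_ord.
  by rewrite leq_mul2r bin_le_exp2 orbT.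
rewrite -expnD (_ : 16 = 2 ^ 4)%N// -expnM leq_exp2l// => h.
apply: (@le_trans _ _ (M%:R)); first by rewrite ler_nat; lia.
by have /andP[] := truncn_itv B0.
Qed.

End LatticeCount.

(** * Greedy Gram-Schmidt selection of columns *)

Section Greedy.
Variables (R : realType) (m : nat) (p : 'I_m -> R) (J : finType).
Variable v : J -> 'rV[R]_m.
Hypothesis p_ge0 : forall i, 0 <= p i.
Local Notation "''[' u , v ]" := (wdot p u v).
Implicit Types (e : nat -> 'rV[R]_m) (js : nat -> J) (k l : nat).

Definition orthonormal k e :=
  forall l l', (l < k)%N -> (l' < k)%N -> '[e l, e l'] = (l == l')%:R.

Lemma orthonormal_resid k e u l : orthonormal k e -> (l < k)%N ->
  '[e l, u - \sum_(0 <= i < k) '[e i, u] *: e i] = 0.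
Proof.
move=> eo lk; rewrite wdotBr wdot_sumr big_mkord (bigD1 (Ordinal lk))//=.
rewrite wdotZr eo// eqxx mulr1 big1 ?addr0 ?subrr// => i il.
rewrite wdotZr eo// (_ : (l == i) = false) ?mulr0//.
by apply/negbTE; rewrite eq_sym; apply: contraNneq il => il; apply/eqP/val_inj.
Qed.

Lemma orthonormal_residE k e u : orthonormal k e ->
  '[u - \sum_(0 <= i < k) '[e i, u] *: e i, u - \sum_(0 <= i < k) '[e i, u] *: e i]
  = '[u, u] - \sum_(0 <= i < k) '[e i, u] ^+ 2.
Proof.
move=> eo; set rs := u - _.
have -> : '[rs, rs] = '[u, rs] - \sum_(0 <= i < k) '[e i, u] * '[e i, rs].
  rewrite {1}/rs wdotBl wdot_suml; congr (_ - _).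
  by apply: eq_bigr => i _; rewrite wdotZl.
rewrite [X in _ - X = _]big_nat big1 ?subr0; last first.
  by move=> i /andP[_ ik]; rewrite orthonormal_resid// mulr0.
rewrite wdotBr wdot_sumr; congr (_ - _); apply: eq_bigr => i _.
by rewrite wdotZr (wdotC _ u).
Qed.

Lemma bessel k e u : orthonormal k e -> \sum_(0 <= i < k) '[e i, u] ^+ 2 <= '[u, u].
Proof. by move=> /(@orthonormal_residE _ _ u) h; rewrite -subr_ge0 -h wdot_ge0. Qed.

(** This both stops the greedy choice and bounds the later harmonic sum by the logarithm of the
    number of rows. *)
Lemma orthonormal_size k e : orthonormal k e -> (k <= m)%N.
Proof.
move=> eo; pose E : 'M[R]_(k, m) := \matrix_(l, i) e l 0 i.
pose F : 'M[R]_(m, k) := \matrix_(i, l) (p i * e l 0 i).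
have EF : E *m F = 1%:M.
  apply/matrixP => l l'; rewrite !mxE -val_eqE/= -eo//.
  by apply: eq_bigr => i _; rewrite !mxE; ring.
have := mxrankM_maxl E F; rewrite EF mxrank1 => h.
exact: leq_trans h (rank_leq_col E).
Qed.

(* Columns [js 0, js 1, ...] are chosen with the largest residual, and [e] is
   their Gram-Schmidt basis. *)
Definition greedy k e js :=
  [/\ orthonormal k e,
      forall l, (l < k)%N -> 0 < '[e l, v (js l)],
      forall l, (l < k)%N ->
        '[v (js l), v (js l)] = \sum_(0 <= i < l.+1) '[e i, v (js l)] ^+ 2 &
      forall l j, (l < k)%N ->
        '[v j, v j] - \sum_(0 <= i < l) '[e i, v j] ^+ 2 <= '[e l, v (js l)] ^+ 2].

(** Spanning up to vectors of norm 0, which is all a degenerate inner product can express. *)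
Definition complete k e :=
  forall j, '[v j, v j] = \sum_(0 <= i < k) '[e i, v j] ^+ 2.

Lemma greedy_extend (j0 : J) k e js : greedy k e js ->
  complete k e \/ exists e' js', greedy k.+1 e' js'.
Proof.
move=> [eo epos ez emax].
pose rs j := v j - \sum_(0 <= i < k) '[e i, v j] *: e i.
pose g j := '[rs j, rs j].
have gE j : g j = '[v j, v j] - \sum_(0 <= i < k) '[e i, v j] ^+ 2.
  exact: orthonormal_residE.
have [j1 _ jmax] := @arg_maxP _ R J j0 xpredT g isT.
have [g0|g0] := eqVneq (g j1) 0.
  left=> j; have := jmax j isT; rewrite g0 /= => h.
  have : g j = 0 by apply/eqP; rewrite eq_le h; exact: wdot_ge0.
  by rewrite gE => /eqP; rewrite subr_eq0 => /eqP.
right; have gp : 0 < g j1 by rewrite lt_def g0 wdot_ge0.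
pose s := Num.sqrt (g j1); have s0 : 0 < s by rewrite sqrtr_gt0.
have s2 : s ^+ 2 = g j1 by rewrite sqr_sqrtr// ltW.
pose n := s^-1 *: rs j1.
pose e' i := if i == k then n else e i; pose js' i := if i == k then j1 else js i.
have e'E i : (i < k)%N -> e' i = e i.
  by move=> ik; rewrite /e' ltn_eqF.
have js'E i : (i < k)%N -> js' i = js i.
  by move=> ik; rewrite /js' ltn_eqF.
have ke : e' k = n by rewrite /e' eqxx.
have kjs : js' k = j1 by rewrite /js' eqxx.
have ne i : (i < k)%N -> '[e i, n] = 0.
  by move=> ik; rewrite wdotZr orthonormal_resid// mulr0.
have nn : '[n, n] = 1.
  by rewrite wdotZl wdotZr -/(g j1) -s2; field; rewrite gt_eqF.
have nv : '[n, v j1] = s.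
  have -> : v j1 = rs j1 + \sum_(0 <= i < k) '[e i, v j1] *: e i by rewrite subrK.
  rewrite wdotDr wdot_sumr [X in _ + X]big_nat big1 ?addr0; last first.
    by move=> i /andP[_ ik]; rewrite wdotZr (wdotC _ n) ne// mulr0.
  by rewrite wdotZl -/(g j1) -s2; field; rewrite gt_eqF.
have sumE l (u : 'rV_m) : (l <= k)%N ->
   \sum_(0 <= i < l) '[e' i, u] ^+ 2 = \sum_(0 <= i < l) '[e i, u] ^+ 2.
  move=> lk; apply: eq_big_nat => i /andP[_ il].
  by rewrite e'E//; exact: leq_trans lk.
exists e', js'; split.
- move=> l l'; rewrite ltnS leq_eqVlt => /predU1P[->|lk];
    rewrite ltnS leq_eqVlt => /predU1P[->|lk'].
  + by rewrite ke nn eqxx.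
  + by rewrite ke e'E// wdotC ne// gtn_eqF.
  + by rewrite ke e'E// ne// ltn_eqF.
  + by rewrite !e'E// eo.
- move=> l; rewrite ltnS leq_eqVlt => /predU1P[->|lk].
    by rewrite ke kjs nv.
  by rewrite e'E// js'E// epos.
- move=> l; rewrite ltnS leq_eqVlt => /predU1P[->|lk].
    rewrite big_nat_recr//= sumE// ke kjs nv s2 gE; ring.
  by rewrite js'E// sumE// ez.
- move=> l j; rewrite ltnS leq_eqVlt => /predU1P[->|lk].
    by rewrite sumE// ke kjs nv s2 -gE; exact: jmax.
  by rewrite e'E// js'E// sumE ?emax// ltnW.
Qed.

Lemma greedy_complete (j0 : J) : exists k e js, greedy k e js /\ complete k e.
Proof.
suff H n : exists k e js, greedy k e js /\ (complete k e \/ k = n).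
  have [k [e [js [gr [co|km]]]]] := H m.+1; first by exists k, e, js.
  by have [/orthonormal_size + _ _ _] := gr; rewrite km ltnn.
elim: n => [|n [k [e [js [gr [co|kn]]]]]].
- by exists 0%N, (fun=> 0), (fun=> j0); split; [split|right].
- by exists k, e, js; split=> //; left.
- have [co|[e' [js' gr']]] := greedy_extend j0 gr.
    by exists k, e, js; split=> //; left.
  by exists k.+1, e', js'; split=> //; right; rewrite kn.
Qed.

(** The column [v (js i)] spends its whole squared norm on the basis vectors up to i, so Bessel's
    inequality leaves nothing for e l. *)
Lemma greedy_upper k e js i l : greedy k e js -> (i < l)%N -> (l < k)%N ->
  '[e l, v (js i)] = 0.
Proof.
move=> [eo _ ez _] il lk.
have := bessel (v (js i)) eo; rewrite ez; last exact: ltn_trans lk.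
rewrite (big_cat_nat (n := i.+1))//=; last by exact: ltn_trans lk.
rewrite gerDl (big_cat_nat (n := l))//=; last exact: ltnW.
rewrite [X in _ + X]big_ltn//= => h.
have s1 (a b : nat) : 0 <= \sum_(a <= t < b) '[e t, v (js i)] ^+ 2.
  by apply: sumr_ge0 => t _; rewrite sqr_ge0.
have h1 := s1 i.+1 l; have h2 := s1 l.+1 k; have h3 := sqr_ge0 '[e l, v (js i)].
by apply/eqP; rewrite -sqrf_eq0 eq_le h3 andbT; lra.
Qed.

(** The residual of column [js k] after l choices still contains its last component, and it competed
    for the l-th maximum. *)
Lemma greedy_decr k e js l : greedy k.+1 e js -> (l <= k)%N ->
  '[e k, v (js k)] <= '[e l, v (js l)].
Proof.
move=> [eo epos ez emax] lk.
have lk1 : (l < k.+1)%N by [].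
have := emax l (js k) lk1; rewrite ez// (big_cat_nat (n := l))//=; last exact: ltnW.
rewrite addrAC subrr add0r big_nat_recr//=.
have s1 : 0 <= \sum_(l <= t < k) '[e t, v (js k)] ^+ 2.
  by apply: sumr_ge0 => t _; rewrite sqr_ge0.
have := epos l lk1; have := epos k (ltnSn k); move=> *; nra.
Qed.

Lemma greedy_inj k e js : greedy k e js ->
  injective (fun l : 'I_k => js l).
Proof.
move=> gr; have H (i l : 'I_k) : (i < l)%N -> js i <> js l.
  move=> il h; have := greedy_upper gr il (ltn_ord l); rewrite h.
  by have [_ epos _ _] := gr; have := epos l (ltn_ord l); move=> /gt_eqF/eqP.
move=> i l h; apply/val_inj; case: (ltngtP i l) => // il; first by case: (H _ _ il).
by case: (H _ _ il).
Qed.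

End Greedy.

(** * Decay of the greedy residuals *)

Section GreedyRadius.
Variable R : realType.

Lemma sum_on_image (K J : finType) (h : K -> J) (F : J -> R) : injective h ->
  (forall j, (forall l, h l != j) -> F j = 0) -> \sum_j F j = \sum_l F (h l).
Proof.
move=> hi F0; have := push_sum h (fun=> 1) F.
under [RHS]eq_bigr do rewrite mul1r; move=> <-; apply: eq_bigr => j _.
have [l /eqP <-|hj] := pickP (fun l => h l == j).
  by rewrite (bigD1 l)//= big1 ?addr0 ?mul1r// => i; rewrite (inj_eq hi) => /andP[/eqP ->]; rewrite eqxx.
by rewrite F0 ?mulr0// => l; rewrite hj.
Qed.

Variables (m : nat) (p : 'I_m -> R) (J : finType) (a : 'I_m -> J -> R) (D : R).
Hypotheses (pp : is_prob p) (D0 : 0 <= D) (aD : hdisc_le a D).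
Local Notation "''[' u , v ]" := (wdot p u v).
Let v j : 'rV[R]_m := \row_i a i j.
Let p0 : forall i, 0 <= p i := pp.1.

Lemma greedy_radius k e js : greedy p v k.+1 e js ->
  k.+1%:R * '[e k, v (js k)] ^+ 2 <= 128 * D ^+ 2.
Proof.
move=> gr; have [eo epos _ _] := gr.
have r0 := epos k (ltnSn k); set r := '[e k, _] in r0 *.
(* The triangular matrix of the chosen columns, with each row divided by its diagonal entry so that
   [tri] has unit diagonal. *)
pose cf (l i : 'I_k.+1) := '[e l, v (js i)] / '[e l, v (js l)].
suff H : (2 * k.+1)%:R <= 256 * D ^+ 2 / r ^+ 2.
  rewrite ler_pdivlMr ?exprn_gt0// in H; rewrite natrM in H; lra.
apply: (@residues_tri_bound _ _ cf) => Z.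
have hi := greedy_inj p0 gr.
pose z j : int := \sum_(l < k.+1) (if js l == j then (Z l : nat)%:Z else 0).
have zE (l : 'I_k.+1) : z (js l) = (Z l : nat)%:Z.
  rewrite /z (bigD1 l)//= eqxx big1 ?addr0// => i il.
  by rewrite (negbTE (_ : js i != js l))//; rewrite (inj_eq hi).
have z0 j : (forall l : 'I_k.+1, js l != j) -> z j = 0.
  by move=> h; rewrite /z big1// => l _; rewrite (negbTE (h l)).
have [y [w [yw y0 yle]]] := round_residues D0 aD 4 z.
exists (fun l => y (js l)), (fun l => w (js l)); split.
  by move=> l; rewrite -zE yw.
set yy := fun l : 'I_k.+1 => _.
pose u : 'rV[R]_m := \sum_(l < k.+1) (yy l)%:~R *: v (js l).
have uE i : u 0 i = \sum_j a i j * (y j)%:~R.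
  rewrite /u summxE [RHS](sum_on_image hi) => [|j hj].
    by apply: eq_bigr => l _; rewrite !mxE mulrC.
  by rewrite y0 ?mulr0// z0.
(* As [p] is a probability, the squared p-norm is at most the largest squared entry, here (15
   D)^2. *)
have uu : '[u, u] <= 256 * D ^+ 2.
  apply: (@le_trans _ _ (\sum_i p i * (256 * D ^+ 2))); last first.
    by rewrite -mulr_suml pp.2 mul1r.
  apply: ler_sum => i _; rewrite -mulrA ler_wpM2l// -expr2 uE.
  have := yle i; have := normr_ge0 (\sum_j a i j * (y j)%:~R).
  set x := \sum_j _; rewrite -(@real_normK _ x) ?num_real//.
  set q := `|_|; have -> : (2 ^ 4 - 1)%:R = 15 :> R by [].
  move=> *; nra.
have eu (l : 'I_k.+1) : '[e l, u] = '[e l, v (js l)] * tri cf yy l.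
  have lp := epos l (ltn_ord l).
  rewrite /u wdot_sumr (bigD1 l)//= wdotZr /tri mulrDr [_ * (yy l)%:~R]mulrC.
  congr (_ + _); rewrite mulr_sumr big_mkcond [RHS]big_mkcond; apply: eq_bigr => i _ /=.
  case: (ltngtP l i) => li.
  - rewrite ifT; last by rewrite -val_eqE /= gtn_eqF.
    by rewrite wdotZr /cf; field; rewrite gt_eqF.
  - by rewrite wdotZr (greedy_upper p0 gr li (ltn_ord l)) mulr0; case: ifP.
  - by rewrite -val_eqE /= li eqxx.
rewrite ler_pdivlMr ?exprn_gt0// mulrC mulr_sumr.
apply: le_trans uu; apply: le_trans (bessel p0 u eo).
rewrite big_mkord; apply: ler_sum => l _; rewrite eu exprMn.
apply: ler_wpM2r; first exact: sqr_ge0.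
have := greedy_decr gr (ltn_ord l : (l <= k)%N); rewrite -/r => h.
by rewrite ler_pXn2r// nnegrE ltW//; apply: lt_le_trans h.
Qed.

End GreedyRadius.

(** * Witness values against hereditary discrepancy *)

Section WitnessBound.
Variable R : realType.

Lemma harmonic_le (k : nat) : (0 < k)%N ->
  \sum_(0 <= i < k) (i.+1%:R)^-1 <= 1 + ln (k%:R : R).
Proof.
case: k => // k _; elim: k => [|k IH]; first by rewrite big_nat1 ln1 addr0 invr1.
rewrite big_nat_recr//=.
suff : (k.+2%:R)^-1 <= ln (k.+2%:R : R) - ln k.+1%:R.
  rewrite lerBrDl => h; apply: (@le_trans _ _ (1 + ln k.+1%:R + (k.+2%:R)^-1)).
    by rewrite lerD2r.
  by rewrite -addrA lerD2l.
have k0 : 0 < k.+1%:R :> R by rewrite ltr0n.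
have k1 : 0 < k.+2%:R :> R by rewrite ltr0n.
have e : k.+2%:R = k.+1%:R + 1 :> R by rewrite natr1.
have := @le_ln1Dx R (- (k.+2%:R)^-1).
have i1 : (k.+2%:R)^-1 < 1 :> R by rewrite invf_lt1// ltr1n.
rewrite ltrN2 => /(_ i1).
have -> : 1 + - (k.+2%:R)^-1 = k.+1%:R / k.+2%:R :> R.
  move: k1; rewrite e; move: (k.+1%:R : R) => x x1; field; exact: lt0r_neq0.
by rewrite ln_div ?posrE// lerNr opprB.
Qed.

Lemma sum_weighted_tails (x : nat -> R) k :
  \sum_(0 <= l < k) l.+1%:R * x l = \sum_(0 <= i < k) \sum_(i <= l < k) x l.
Proof.
elim: k => [|k IH]; first by rewrite !big_nil.
rewrite big_nat_recr//= IH [RHS]big_nat_recr//= big_nat1.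
rewrite [X in _ = X + _](_ : _ = \sum_(0 <= i < k) (\sum_(i <= l < k) x l + x k)).
  rewrite big_split/= sumr_const_nat subn0 -addrA.
  by rewrite -natr1 mulrDl mul1r mulr_natl.
by apply: eq_big_nat => i /andP[_ ik]; rewrite big_nat_recr//= ltnW.
Qed.

Lemma dominated_scaled (I J : finType) (p : I -> R) (q : J -> R) (T : I -> J -> R)
    (s : R) b c : dominated p q T -> 0 < s ->
  bilin T b c <= (s * (\sum_i p i * b i ^+ 2) + s^-1 * \sum_j q j * c j ^+ 2) / 2.
Proof.
move=> dom s0; pose u := Num.sqrt s; have u0 : 0 < u by rewrite sqrtr_gt0.
have u2 : u ^+ 2 = s by rewrite sqr_sqrtr// ltW.
have := dom (fun i => u * b i) (fun j => u^-1 * c j).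
have -> : bilin T (fun i => u * b i) (fun j => u^-1 * c j) = bilin T b c.
  apply: eq_bigr => i _; apply: eq_bigr => j _; field; exact: lt0r_neq0.
under eq_bigr do rewrite exprMn u2 mulrCA.
under [X in _ + X]eq_bigr do rewrite exprMn exprVn u2 mulrCA.
by rewrite -!mulr_sumr.
Qed.

Lemma witness_bound_ord (m : nat) (J : finType) (a : 'I_m -> J -> R) (D w : R) :
  (2 <= m)%N -> 0 < D -> hdisc_le a D -> witness a w ->
  w <= 36 * D * ln (m%:R : R).
Proof.
move=> m2 D0 aD [p [q [T [pp qp dom <-]]]].
have p0 : forall i, 0 <= p i := pp.1.
have [j0 _|J0] := pickP (fun _ : J => true); last first.
  have [_] := qp; rewrite big_pred0; last by move=> j; have := J0 j.
  by move/eqP; rewrite eq_sym oner_eq0.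
pose v j : 'rV[R]_m := \row_i a i j.
have [k [e [js [gr co]]]] := greedy_complete v p0 j0.
have [eo epos _ emax] := gr.
pose f l j := wdot p (e l) (v j).
pose rs j := v j - \sum_(0 <= l < k) f l j *: e l.
have rs0 j : wdot p (rs j) (rs j) = 0.
  by rewrite orthonormal_residE// co subrr.
(* Completeness gives the expansion of [a] only on rows with p i > 0; on the others T vanishes. *)
have TE i j : T i j * a i j = T i j * \sum_(0 <= l < k) f l j * e l 0 i.
  have [pi0|pin] := eqVneq (p i) 0.
    have := dominated_row0 (fun j' => (j' == j)%:R) dom pi0.
    rewrite (bigD1 j)//= eqxx mulr1 big1 ?addr0 => [->|j' /negbTE ->].
      by rewrite !mul0r.
    by rewrite mulr0.
  have : p i * rs j 0 i * rs j 0 i = 0.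
    have := rs0 j; rewrite /wdot => /eqP; rewrite psumr_eq0.
      by move=> /allP/(_ i); rewrite mem_index_enum => /(_ isT)/eqP.
    by move=> i' _; rewrite -mulrA mulr_ge0// -expr2 sqr_ge0.
  move=> /eqP; rewrite !mulf_eq0 (negbTE pin)/= orbb => /eqP.
  rewrite /rs !mxE summxE => /eqP; rewrite subr_eq0 => /eqP ->.
  by congr (_ * _); apply: eq_bigr => l _; rewrite !mxE.
have -> : \sum_i \sum_j T i j * a i j =
    \sum_(0 <= l < k) bilin T (fun i => e l 0 i) (f l).
  rewrite [RHS]exchange_big/=; apply: eq_bigr => i _.
  rewrite [RHS]exchange_big/=; apply: eq_bigr => j _.
  by rewrite TE mulr_sumr; apply: eq_bigr => l _; ring.
(* 12^2 = 144 dominates the 128 of [greedy_radius]. *)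
pose K := 12 * D; have K0 : 0 < K by rewrite mulr_gt0.
pose H := \sum_(0 <= l < k) (l.+1%:R)^-1 : R.
have radius l : (l < k)%N -> f l (js l) ^+ 2 <= K ^+ 2 / l.+1%:R.
  move=> lk; have gr' : greedy p v l.+1 e js.
    have [g1 g2 g3 g4] := gr; split.
    - by move=> i i' il il'; apply: g1; exact: leq_trans lk.
    - by move=> i il; apply: g2; exact: leq_trans lk.
    - by move=> i il; apply: g3; exact: leq_trans lk.
    - by move=> i j il; apply: g4; exact: leq_trans lk.
  rewrite ler_pdivlMr ?ltr0n// mulrC.
  apply: le_trans (greedy_radius pp (ltW D0) aD gr') _.
  by rewrite /K; have := sqr_ge0 D; lra.
(* Summation by parts turns the weights l + 1 into residuals of column j after l choices; each is at
   most the greedy maximum, hence at most K^2 / (l + 1). *)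
have tails j : \sum_(0 <= l < k) l.+1%:R * f l j ^+ 2 <= K ^+ 2 * H.
  rewrite sum_weighted_tails /H mulr_sumr big_nat [leRHS]big_nat.
  apply: ler_sum => l /andP[_ lk].
  apply: le_trans (radius l lk); apply: le_trans (emax l j lk).
  by rewrite co [X in _ <= X - _](big_cat_nat (n := l))//= ?(ltnW lk)// addrAC subrr add0r.
apply: (@le_trans _ _ (\sum_(0 <= l < k)
   (K / l.+1%:R + l.+1%:R / K * \sum_j q j * f l j ^+ 2) / 2)).
  rewrite big_nat [leRHS]big_nat; apply: ler_sum => l /andP[_ lk].
  (* This scale gives both halves of the domination bound, summed over l, the same bound K H. *)
  have s0 : 0 < K / l.+1%:R by rewrite divr_gt0// ltr0n.
  have := dominated_scaled (fun i => e l 0 i) (f l) dom s0.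
  rewrite invf_div; have -> : \sum_i p i * e l 0 i ^+ 2 = 1.
    have := eo l l lk lk; rewrite eqxx => eo1; rewrite -[RHS]eo1; apply: eq_bigr => i _.
    by rewrite expr2 mulrA.
  by rewrite mulr1.
rewrite -mulr_suml big_split/= -mulr_sumr -/H.
have -> : \sum_(0 <= l < k) l.+1%:R / K * \sum_j q j * f l j ^+ 2 =
    (\sum_j q j * \sum_(0 <= l < k) l.+1%:R * f l j ^+ 2) / K.
  rewrite mulr_suml; under eq_bigr do rewrite mulr_sumr.
  rewrite exchange_big/=; apply: eq_bigr => j _.
  by rewrite mulr_sumr mulr_suml; apply: eq_bigr => l _; ring.
have qK : \sum_j q j * (\sum_(0 <= l < k) l.+1%:R * f l j ^+ 2) <= K ^+ 2 * H.
  apply: (@le_trans _ _ (\sum_j q j * (K ^+ 2 * H))).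
    by apply: ler_sum => j _; apply: ler_wpM2l (tails j); exact: qp.1.
  by rewrite -mulr_suml qp.2 mul1r.
have KH : (K * H + (\sum_j q j * (\sum_(0 <= l < k) l.+1%:R * f l j ^+ 2)) / K) / 2
    <= K * H.
  have : (\sum_j q j * (\sum_(0 <= l < k) l.+1%:R * f l j ^+ 2)) / K <= K * H.
    by rewrite ler_pdivrMr// mulrAC -expr2.
  lra.
apply: le_trans KH _.
have lm := ln_nat_ge_half R m2.
have H3 : H <= 3 * ln (m%:R : R).
  have [k0|k0] := posnP k; first by rewrite /H k0 big_nil; lra.
  apply: le_trans (harmonic_le k0) _.
  have : ln (k%:R : R) <= ln m%:R.
    rewrite ler_ln ?posrE ?ltr0n//; last by lia.
    by rewrite ler_nat; exact: orthonormal_size eo.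
  lra.
have : K * H <= K * (3 * ln (m%:R : R)) by rewrite ler_pM2l.
rewrite /K; lra.
Qed.

Lemma witness_bound (I J : finType) (a : I -> J -> R) (D w : R) :
  (2 <= #|I|)%N -> 0 < D -> hdisc_le a D -> witness a w ->
  w <= 36 * D * ln (#|I|%:R : R).
Proof.
move=> m2 D0 aD wa.
pose a' (i : 'I_#|I|) j := a (enum_val i) j.
apply: (@witness_bound_ord _ _ a') => //.
  by move=> S; have [x [x1 xle]] := aD S; exists x; split=> // i; exact: xle.
apply: (witness_push (f := enum_rank) (h := id)) wa.
by move=> i j; rewrite /a' enum_rankK.
Qed.

End WitnessBound.

(** * Duality *)

Section PositiveSemidefinite.
Variables (R : realType) (K : finType).
Implicit Types (X : K -> K -> R) (z : K -> R).

Definition qform X z := \sum_k \sum_l z k * z l * X k l.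
Definition psd X := (forall k l, X k l = X l k) /\ forall z, 0 <= qform X z.

Lemma qformD1 X z k0 (s : R) : (forall k l, X k l = X l k) ->
  qform X (fun k => z k + s * (k == k0)%:R) =
  qform X z + 2 * s * (\sum_l z l * X k0 l) + s ^+ 2 * X k0 k0.
Proof.
move=> Xs.
have pick1 (F : K -> R) : \sum_k (k == k0)%:R * F k = F k0.
  by rewrite (bigD1 k0)//= eqxx mul1r big1 ?addr0// => k /negbTE ->; rewrite mul0r.
rewrite /qform (eq_bigr (fun k => \sum_l z k * z l * X k l + s * (z k * X k0 k) +
   (k == k0)%:R * (s * (\sum_l z l * X k l) + s ^+ 2 * X k k0))); last first.
  move=> k _; rewrite (Xs k0 k) -(pick1 (fun l => z k * X k l)) -(pick1 (fun l => X k l)).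
  rewrite !(mulr_sumr, mulrDr) -!big_split/=; apply: eq_bigr => l _; ring.
by rewrite !big_split/= pick1 -mulr_sumr; ring.
Qed.

Lemma qform_pair X k l (s : R) : (forall k l, X k l = X l k) ->
  qform X (fun x => (x == l)%:R + s * (x == k)%:R) =
  X l l + 2 * s * X k l + s ^+ 2 * X k k.
Proof.
move=> Xs; rewrite qformD1//; congr (_ + _ * _ + _).
  have -> : (fun x => (x == l)%:R) = (fun x => 0 + 1 * (x == l)%:R) :> (K -> R).
    by apply/funext => x; rewrite add0r mul1r.
  rewrite qformD1// /qform big1 => [|i _]; last by rewrite big1// => j _; rewrite !mul0r.
  by rewrite big1 => [|i _]; rewrite ?mul0r// mulr0 !add0r expr1n mul1r.
by rewrite (bigD1 l)//= eqxx mul1r big1 ?addr0// => x /negbTE ->; rewrite mul0r.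
Qed.

Lemma psd_diag_ge0 X k : psd X -> 0 <= X k k.
Proof. by move=> [Xs /(_ (fun x => (x == k)%:R + 0 * (x == k)%:R))]; rewrite qform_pair//; lra. Qed.

Lemma psd_offdiag X k l : psd X -> `|X k l| <= (X k k + X l l) / 2.
Proof.
move=> [Xs Xp]; have := Xp (fun x => (x == l)%:R + 1 * (x == k)%:R).
have := Xp (fun x => (x == l)%:R + (- 1) * (x == k)%:R).
by rewrite !qform_pair// ler_norml; lra.
Qed.

Lemma psd_diag0 X k l : psd X -> X k k = 0 -> X k l = 0.
Proof.
move=> [Xs Xp] k0; apply/eqP; apply: contraT => kl.
have := Xp (fun x => (x == l)%:R + (- (X l l + 1) / (2 * X k l)) * (x == k)%:R).
rewrite qform_pair// k0 mulr0 addr0.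
rewrite (_ : 2 * _ * _ = - (X l l + 1)); first lra.
by field.
Qed.

Lemma psdD X Y (s : R) : 0 <= s -> psd X -> psd Y -> psd (fun k l => X k l + s * Y k l).
Proof.
move=> s0 [Xs Xp] [Ys Yp]; split=> [k l|z]; first by rewrite Xs Ys.
have -> : qform (fun k l => X k l + s * Y k l) z = qform X z + s * qform Y z.
  rewrite mulr_sumr -big_split; apply: eq_bigr => k _ /=.
  rewrite mulr_sumr -big_split; apply: eq_bigr => l _ /=; ring.
by rewrite addr_ge0// mulr_ge0.
Qed.

Lemma psd0 : psd (fun _ _ : K => 0 : R).
Proof.
by split=> // z; rewrite /qform big1// => k _; rewrite big1// => l _; rewrite mulr0.
Qed.

Lemma psdZ X (s : R) : 0 <= s -> psd X -> psd (fun k l => s * X k l).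
Proof.
move=> s0 Xp; have [Hs Hp] := psdD s0 psd0 Xp; split=> [k l|z]; first by rewrite Xp.1.
have -> : (fun k l => s * X k l) = (fun k l => 0 + s * X k l) :> (K -> K -> R).
  by apply/funext => k; apply/funext => l; rewrite add0r.
exact: Hp.
Qed.

Lemma psd_rank1 z : psd (fun k l => z k * z l).
Proof.
split=> [k l|y]; first by rewrite mulrC.
rewrite /qform (_ : \sum_k _ = (\sum_k y k * z k) ^+ 2) ?sqr_ge0//.
rewrite expr2 big_distrlr/=; apply: eq_bigr => k _; apply: eq_bigr => l _; ring.
Qed.

(** The new form at z is the minimum of the old one over changes of z at k0, reached at -y / X k0
    k0. *)
Lemma psd_schur X k0 : psd X -> X k0 k0 != 0 ->
  psd (fun k l => X k l - X k0 k * X k0 l / X k0 k0).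
Proof.
move=> [Xs Xp] x0; split=> [k l|z]; first by rewrite Xs [X k0 k * _]mulrC.
pose y := \sum_l z l * X k0 l.
have := Xp (fun k => z k + (- y / X k0 k0) * (k == k0)%:R).
rewrite qformD1// -/y.
have -> : qform (fun k l => X k l - X k0 k * X k0 l / X k0 k0) z =
    qform X z - y ^+ 2 / X k0 k0.
  rewrite expr2 /y big_distrlr/= mulr_suml -sumrB; apply: eq_bigr => k _.
  by rewrite mulr_suml -sumrB; apply: eq_bigr => l _; ring.
by rewrite (_ : _ + _ + _ = qform X z - y ^+ 2 / X k0 k0)//; field.
Qed.

(** Cholesky elimination: each Schur complement clears a nonzero diagonal entry and creates none,
    and a zero diagonal entry forces a zero row. *)
Lemma psd_gram X : psd X ->
  exists (d : finType) (u : K -> d -> R), forall k l, X k l = \sum_t u k t * u l t.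
Proof.
have [n] := ubnP #|[set k | X k k != 0]|; elim: n => // n IH in X *.
move=> Xn Xp; have [k0 k00|all0] := pickP (fun k => X k k != 0); last first.
  exists void, (fun _ _ => 0) => k l; rewrite big_pred0; last by case.
  by apply: (psd_diag0 l Xp); apply/eqP; have := all0 k => /negbFE.
pose X' k l := X k l - X k0 k * X k0 l / X k0 k0.
have X'p : psd X' by exact: psd_schur.
have Xpos : 0 < X k0 k0 by rewrite lt_def k00 psd_diag_ge0.
have [|d [u uE]] := IH X' _ X'p.
  rewrite -ltnS; apply: leq_trans Xn; rewrite ltnS.
  apply: proper_card; rewrite properE; apply/andP; split.
    apply/fintype.subsetP => k; rewrite !inE; apply: contraNN => /eqP kk.
    by rewrite /X' kk (Xp.1 k0) (psd_diag0 k0 Xp kk) !mul0r subr0.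
  apply/subsetPn; exists k0; rewrite inE//.
  by rewrite negbK /X' mulfK// subrr.
pose sq := Num.sqrt (X k0 k0); have sq0 : 0 < sq by rewrite sqrtr_gt0.
have sq2 : sq ^+ 2 = X k0 k0 by rewrite sqr_sqrtr// ltW.
exists (option d), (fun k t => if t is Some t' then u k t' else X k0 k / sq) => k l.
rewrite (bigD1 None)//= (reindex_omap Some id)/=; last by case.
rewrite (eq_bigl xpredT); last by move=> t; rewrite eqxx.
rewrite -uE /X' -sq2; field; exact: lt0r_neq0.
Qed.

End PositiveSemidefinite.

Section Continuity.
Import numFieldNormedType.Exports.
Variables (R : realType) (T : topologicalType).
Implicit Types f g : T -> R.
Local Open Scope classical_set_scope.

Lemma continuous_add f g : continuous f -> continuous g -> continuous (fun x => f x + g x).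
Proof. by move=> cf cg x; exact: continuousD (cf x) (cg x). Qed.

Lemma continuous_mul f g : continuous f -> continuous g -> continuous (fun x => f x * g x).
Proof. by move=> cf cg x; exact: continuousM (cf x) (cg x). Qed.

Lemma continuous_const (a : R) : continuous (fun _ : T => a).
Proof. by move=> x; exact: cst_continuous. Qed.

Lemma continuous_finsum (K : Type) (r : seq K) (F : K -> T -> R) :
  (forall k, continuous (F k)) -> continuous (fun x => \sum_(k <- r) F k x).
Proof.
move=> cF; elim: r => [|k r IH].
  have -> : (fun x => \sum_(k <- [::]) F k x) = (fun=> 0).
    by apply/funext => x; rewrite big_nil.
  exact: continuous_const.
have -> : (fun x => \sum_(k <- k :: r) F k x) = (fun x => F k x + \sum_(k <- r) F k x).
  by apply/funext => x; rewrite big_cons.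
exact: continuous_add.
Qed.

Lemma closed_nonneg f : continuous f -> closed [set x | 0 <= f x].
Proof.
move=> cf; apply: (@closed_comp _ _ f [set y | 0 <= y]); last exact: closed_ge.
by move=> x _; exact: cf.
Qed.

End Continuity.

(** * Penalised least squares over the semidefinite cone *)

Section Duality.
Variables (R : realType) (I J : finType) (a : I -> J -> R) (g : R).
Hypothesis g_gt0 : 0 < g.
Local Notation K := (I + J)%type.
Implicit Types X Y : K -> K -> R.

(** It vanishes when the off-diagonal block of X is [a] and the diagonal is at most g, so that Gram
    vectors of X factorize [a]. Squaring the positive part makes it differentiable. *)
Definition penalty X : R :=
  \sum_i \sum_j (a i j - X (inl i) (inr j)) ^+ 2 +
  (\sum_k Num.max (X k k - g) 0 ^+ 2) / 2.

Lemma sum_sqr_ge0 (E : finType) (F : E -> R) : 0 <= \sum_k F k ^+ 2.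
Proof. by apply: sumr_ge0 => k _; rewrite sqr_ge0. Qed.

(** Coercivity: with [psd_offdiag] it bounds all entries on a sublevel set, which gives
    compactness. *)
Lemma penalty_diag X k : X k k <= g + 1 + 2 * penalty X.
Proof.
set x := Num.max (X k k - g) 0.
have h1 : x ^+ 2 <= 2 * penalty X.
  have s1 : 0 <= \sum_i \sum_j (a i j - X (inl i) (inr j)) ^+ 2.
    by apply: sumr_ge0 => i _; exact: sum_sqr_ge0.
  have : x ^+ 2 <= \sum_k Num.max (X k k - g) 0 ^+ 2.
    by rewrite (bigD1 k)//= lerDl; apply: sumr_ge0 => l _; rewrite sqr_ge0.
  rewrite /penalty; lra.
have h2 : X k k - g <= x by rewrite le_max lexx.
have := sqr_ge0 (x - 1); nra.
Qed.

Section Minimizer.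
Import numFieldNormedType.Exports.
Local Open Scope classical_set_scope.

Lemma penalty_min : exists X, psd X /\ forall Y, psd Y -> penalty X <= penalty Y.
Proof.
pose n := #|{: K * K}|.
pose mat (M : 'rV[R]_n) : K -> K -> R := fun k l => M 0 (enum_rank (k, l)).
pose row X : 'rV[R]_n := \row_t X (enum_val t).1 (enum_val t).2.
have rowK X : mat (row X) = X.
  by apply/funext => k; apply/funext => l; rewrite /mat mxE enum_rankK.
have mat_cts k l : continuous (fun M => mat M k l) by exact: coord_continuous.
(* Every psd kernel at least as good as 0 has its entries in [-B, B]. *)
pose P0 := penalty (fun _ _ => 0); pose B := g + 1 + 2 * P0.
pose box := [set M : 'rV[R]_n | forall t, `[- B, B] (M ord0 t)].
pose S := box `&` [set M | psd (mat M)].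
have boxc : compact box.
  exact: (@rV_compact R n (fun=> `[- B, B]) (fun=> @segment_compact R _ _)).
have psdE : [set M | psd (mat M)] =
    (\bigcap_(kl in [set: K * K]) [set M | 0 <= mat M kl.1 kl.2 - mat M kl.2 kl.1])
    `&` (\bigcap_(z in [set: K -> R]) [set M | 0 <= qform (mat M) z]).
  apply/seteqP; split=> M /=.
    move=> [Ms Mp]; split=> [[k l] _ /=|z _ /=]; last exact: Mp.
    by rewrite Ms subrr.
  move=> [Ms Mp]; split=> [k l|z]; last exact: Mp.
  have := Ms (k, l) Logic.I; have := Ms (l, k) Logic.I; rewrite /= => h1 h2.
  by apply/eqP; rewrite eq_le; lra.
have psdc : closed [set M | psd (mat M)].
  rewrite psdE; apply: closedI; apply: closed_bigI => x _; apply: closed_nonneg.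
    apply: continuous_add; first exact: mat_cts.
    have -> : (fun M => - mat M x.2 x.1) = (fun M => -1 * mat M x.2 x.1).
      by apply/funext => M; rewrite mulN1r.
    by apply: continuous_mul; [exact: continuous_const|exact: mat_cts].
  apply: continuous_finsum => k; apply: continuous_finsum => l.
  by apply: continuous_mul; [exact: continuous_const|exact: mat_cts].
have Sc : compact S by apply: compact_closedI.
have inS X : psd X -> penalty X <= P0 -> S (row X).
  move=> Xp XP; split; last by rewrite /= rowK.
  have dg k : X k k <= B.
    apply: le_trans (penalty_diag X k) _; rewrite /B; lra.
  move=> t; rewrite /= in_itv/= -ler_norml mxE.
  apply: le_trans (psd_offdiag _ _ Xp) _.
  have := dg (enum_val t).1; have := dg (enum_val t).2; lra.
have S0 : S !=set0 by exists (row (fun _ _ => 0)); apply: inS => //; exact: psd0.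
have pc : continuous (fun M => penalty (mat M)).
  apply: continuous_add.
    apply: continuous_finsum => i; apply: continuous_finsum => j.
    have c1 : continuous (fun M => a i j - mat M (inl i) (inr j)).
      have -> : (fun M => a i j - mat M (inl i) (inr j)) =
                (fun M => a i j + -1 * mat M (inl i) (inr j)).
        by apply/funext => M; rewrite mulN1r.
      apply: continuous_add; first exact: continuous_const.
      by apply: continuous_mul; [exact: continuous_const|exact: mat_cts].
    exact: continuous_mul.
  apply: continuous_mul; last exact: continuous_const.
  apply: continuous_finsum => k.
  have c1 : continuous (fun M => Num.max (mat M k k - g) 0).
    have c2 : continuous (fun M => mat M k k - g).
      by apply: continuous_add; [exact: mat_cts|exact: continuous_const].
    have c3 : continuous (fun _ : 'rV[R]_n => 0 : R) by exact: continuous_const.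
    by move=> M; exact: (continuous_max (c2 M) (c3 M)).
  exact: continuous_mul.
have [M] := compact_EVT_min S0 Sc (continuous_subspaceT pc).
rewrite inE => -[_ Mp] Mmin; exists (mat M); split=> // Y Yp.
have [YP|YP] := leP (penalty Y) P0.
  by have := Mmin (row Y); rewrite rowK; apply; rewrite inE; exact: inS.
apply: le_trans (ltW YP).
have := Mmin (row (fun _ _ => 0)); rewrite rowK; apply; rewrite inE.
by apply: inS => //; exact: psd0.
Qed.

End Minimizer.

Lemma ge0_of_perturbation (L Q : R) :
  (forall s, 0 < s -> s <= 1 -> 0 <= s * L + s ^+ 2 * Q) -> 0 <= L.
Proof.
move=> H; apply: contraT; rewrite -ltNge => L0.
have Q1 : 0 < `|Q| + 1 by have := normr_ge0 Q; lra.
pose s := Num.min 1 (- L / (2 * (`|Q| + 1))).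
have s0 : 0 < s by rewrite lt_min ltr01 divr_gt0//; lra.
have s1 : s <= 1 by rewrite ge_min lexx.
have s2 : s <= - L / (2 * (`|Q| + 1)) by rewrite ge_min lexx orbT.
have h := H s s0 s1.
have h' : 0 <= L + s * Q.
  by rewrite -(pmulr_rge0 _ s0) mulrDr mulrA -expr2.
have : s * (2 * (`|Q| + 1)) <= - L by rewrite -ler_pdivlMr//; lra.
have : s * Q <= s * `|Q| by rewrite ler_pM2l// ler_norm.
lra.
Qed.

Lemma max0_perturb (t h : R) :
  Num.max (t + h) 0 ^+ 2 <= Num.max t 0 ^+ 2 + 2 * h * Num.max t 0 + h ^+ 2.
Proof.
have := sqr_ge0 (Num.max t 0 + h); rewrite sqrrD.
by case: (ltP (t + h) 0) => h1; case: (ltP t 0) => h2; nra.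
Qed.

(** The derivative of [penalty] at X in direction Y. *)
Definition slope X Y : R :=
  - 2 * (\sum_i \sum_j (a i j - X (inl i) (inr j)) * Y (inl i) (inr j)) +
  \sum_k Num.max (X k k - g) 0 * Y k k.

Lemma penalty_perturb X Y (s : R) :
  penalty (fun k l => X k l + s * Y k l) <= penalty X + s * slope X Y +
  s ^+ 2 * (\sum_i \sum_j Y (inl i) (inr j) ^+ 2 + (\sum_k Y k k ^+ 2) / 2).
Proof.
rewrite /penalty /slope.
have -> : \sum_i \sum_j (a i j - (X (inl i) (inr j) + s * Y (inl i) (inr j))) ^+ 2 =
  \sum_i \sum_j (a i j - X (inl i) (inr j)) ^+ 2
  - 2 * s * \sum_i \sum_j (a i j - X (inl i) (inr j)) * Y (inl i) (inr j)
  + s ^+ 2 * \sum_i \sum_j Y (inl i) (inr j) ^+ 2.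
  rewrite !mulr_sumr -sumrB -big_split/=; apply: eq_bigr => i _.
  rewrite !mulr_sumr -sumrB -big_split/=; apply: eq_bigr => j _; ring.
have : \sum_k Num.max (X k k + s * Y k k - g) 0 ^+ 2 <=
  \sum_k Num.max (X k k - g) 0 ^+ 2 + 2 * s * (\sum_k Num.max (X k k - g) 0 * Y k k)
  + s ^+ 2 * \sum_k Y k k ^+ 2.
  rewrite !mulr_sumr -!big_split/=; apply: ler_sum => k _.
  have -> : X k k + s * Y k k - g = X k k - g + s * Y k k by ring.
  have := max0_perturb (X k k - g) (s * Y k k).
  set q := Num.max _ _; set q' := Num.max _ _; lra.
lra.
Qed.

(* First-order optimality of the penalised least-squares problem: either its
   value is 0, which is a factorization, or its residual is a dual witness. *)
Lemma factors_or_witness : factors a g \/ exists2 w, g < w & witness a w.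
Proof.
have [X [Xp Xmin]] := penalty_min.
have slope_ge0 Y : psd Y -> 0 <= slope X Y.
  move=> Yp; apply: ge0_of_perturbation => s s0 _.
  have := Xmin _ (psdD (ltW s0) Xp Yp); have := penalty_perturb X Y s.
  move=> h1 h2; have h := le_trans h2 h1; move: h; rewrite -addrA lerDl; apply.
(* Shrinking X to (1 - s) X stays in the cone, so the direction -X is admissible too. *)
have slope_le0 : 0 <= - slope X X.
  apply: ge0_of_perturbation => s s0 s1.
  have := penalty_perturb X X (- s).
  have e : (fun k l => X k l + - s * X k l) = (fun k l => (1 - s) * X k l).
    by apply/funext => k; apply/funext => l; ring.
  rewrite e sqrrN => h1; have h2 := Xmin _ (psdZ (_ : 0 <= 1 - s) Xp).
  have {h2}h2 : penalty X <= penalty (fun k l => (1 - s) * X k l) by apply: h2; lra.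
  have h := le_trans h2 h1; move: h; rewrite -addrA lerDl mulNr -mulrN; apply.
pose E i j := a i j - X (inl i) (inr j).
pose ps k := Num.max (X k k - g) 0.
have ps0 k : 0 <= ps k by rewrite le_max lexx orbT.
have psX k : g * ps k <= ps k * X k k.
  by rewrite /ps; case: (ltP (X k k - g) 0) => h; nra.
have val0 : g * (\sum_k ps k) <= 2 * \sum_i \sum_j E i j * X (inl i) (inr j).
  have : g * (\sum_k ps k) <= \sum_k ps k * X k k.
    by rewrite mulr_sumr; apply: ler_sum.
  move: slope_le0; rewrite /slope -/ps -/E; lra.
pose N := \sum_i \sum_j E i j ^+ 2.
have N0 : 0 <= N by apply: sumr_ge0 => i _; exact: sum_sqr_ge0.
have valE : \sum_i \sum_j E i j * a i j = N + \sum_i \sum_j E i j * X (inl i) (inr j).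
  rewrite -big_split; apply: eq_bigr => i _; rewrite -big_split.
  by apply: eq_bigr => j _; rewrite /E /=; ring.
have [Nz|Nn] := eqVneq N 0.
  left; have E0 i j : E i j = 0.
    have := Nz; rewrite /N => /eqP; rewrite psumr_eq0 => [/allP/(_ i)|i' _].
      rewrite mem_index_enum => /(_ isT); rewrite psumr_eq0 => [/allP/(_ j)|j' _].
        by rewrite mem_index_enum => /(_ isT); rewrite sqrf_eq0 => /eqP.
      exact: sqr_ge0.
    exact: sum_sqr_ge0.
  have ps00 k : ps k = 0.
    have h : \sum_k ps k <= 0.
      rewrite -(pmulr_rle0 _ g_gt0); apply: le_trans val0 _.
      by rewrite big1 ?mulr0// => i _; rewrite big1// => j _; rewrite E0 mul0r.
    apply/eqP; rewrite eq_le ps0 andbT; apply: le_trans h.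
    by rewrite (bigD1 k)//= lerDl sumr_ge0.
  have Xg k : X k k <= g.
    by have := ps00 k; rewrite /ps => h; rewrite -subr_le0 -h le_max lexx.
  have [d [u uE]] := psd_gram Xp.
  exists d, (fun i => u (inl i)), (fun j => u (inr j)); split.
  - by move=> i j; rewrite -uE; have := E0 i j; rewrite /E => /eqP; rewrite subr_eq0 => /eqP.
  - by move=> i; under eq_bigr do rewrite expr2; rewrite -uE.
  - by move=> j; under eq_bigr do rewrite expr2; rewrite -uE.
right; have Npos : 0 < N by rewrite lt_def Nn.
have [i0 [j0 _]] : exists i0 : I, exists j0 : J, True.
  have [i0 _|I0] := pickP (fun _ : I => true); last first.
    by move: Nn; rewrite /N big_pred0 ?eqxx// => i; have := I0 i.
  have [j0 _|J0] := pickP (fun _ : J => true); first by exists i0, j0.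
  by move: Nn; rewrite /N big1 ?eqxx// => i _; rewrite big_pred0// => j; have := J0 j.
pose c : R := #|{: K}|%:R.
have c0 : 0 < c by rewrite ltr0n; apply/card_gt0P; exists (inl i0).
(* Lifting the weights keeps P and Q positive. In total it costs g * c * de = N, while passing from
   X to [a] gains 2 N, so the inequality stays strict. *)
pose de := N / (g * c); have de0 : 0 < de by rewrite divr_gt0// mulr_gt0.
pose P := \sum_i (ps (inl i) + de); pose Q := \sum_j (ps (inr j) + de).
have P0 : 0 < P.
  rewrite /P (bigD1 i0)//= ltr_wpDr//; last by rewrite ltr_wpDl.
  by apply: sumr_ge0 => i _; rewrite addr_ge0// ltW.
have Q0 : 0 < Q.
  rewrite /Q (bigD1 j0)//= ltr_wpDr//; last by rewrite ltr_wpDl.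
  by apply: sumr_ge0 => i _; rewrite addr_ge0// ltW.
have PQ : g * (P + Q) = g * (\sum_k ps k) + N.
  have -> : P + Q = \sum_k (ps k + de) by rewrite big_sumType.
  rewrite big_split/= sumr_const -mulr_natr -/c mulrDr; congr (_ + _).
  by rewrite /de; field; rewrite !lt0r_neq0.
have big : g * (P + Q) < 2 * \sum_i \sum_j E i j * a i j.
  by rewrite PQ valE; lra.
pose sP := Num.sqrt P; pose sQ := Num.sqrt Q.
have sP0 : 0 < sP by rewrite sqrtr_gt0.
have sQ0 : 0 < sQ by rewrite sqrtr_gt0.
have sP2 : sP ^+ 2 = P by rewrite sqr_sqrtr// ltW.
have sQ2 : sQ ^+ 2 = Q by rewrite sqr_sqrtr// ltW.
exists ((\sum_i \sum_j E i j * a i j) / (sP * sQ)).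
  rewrite ltr_pdivlMr ?mulr_gt0//.
  have : 2 * (sP * sQ) <= P + Q.
    by rewrite -sP2 -sQ2; have := sqr_ge0 (sP - sQ); rewrite sqrrB; lra.
  by rewrite -(ler_pM2l g_gt0); move: big; lra.
exists (fun i => (ps (inl i) + de) / P), (fun j => (ps (inr j) + de) / Q),
  (fun i j => E i j / (sP * sQ)); split.
- split; first by move=> i; rewrite divr_ge0 ?(ltW P0)// addr_ge0// ltW.
  by rewrite -mulr_suml divff// gt_eqF.
- split; first by move=> i; rewrite divr_ge0 ?(ltW Q0)// addr_ge0// ltW.
  by rewrite -mulr_suml divff// gt_eqF.
- move=> b y.
  (* Optimality in the rank-one direction z z^T is the domination inequality for the normalised
     residual. *)
  pose z k := match k with inl i => b i / sP | inr j => y j / sQ end.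
  have := slope_ge0 _ (psd_rank1 z); rewrite /slope -/ps -/E big_sumType/=.
  have -> : \sum_i \sum_j E i j * (b i / sP * (y j / sQ)) =
      bilin (fun i j => E i j / (sP * sQ)) b y.
    apply: eq_bigr => i _; apply: eq_bigr => j _; field.
    by rewrite !lt0r_neq0.
  have le1 : \sum_i ps (inl i) * (b i / sP * (b i / sP)) <=
      \sum_i (ps (inl i) + de) / P * b i ^+ 2.
    apply: ler_sum => i _; rewrite -sP2.
    have -> : ps (inl i) * (b i / sP * (b i / sP)) = ps (inl i) / sP ^+ 2 * b i ^+ 2.
      by field; exact: lt0r_neq0.
    by rewrite ler_wpM2r ?sqr_ge0// ler_pM2r ?invr_gt0 ?exprn_gt0// lerDl ltW.
  have le2 : \sum_j ps (inr j) * (y j / sQ * (y j / sQ)) <=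
      \sum_j (ps (inr j) + de) / Q * y j ^+ 2.
    apply: ler_sum => j _; rewrite -sQ2.
    have -> : ps (inr j) * (y j / sQ * (y j / sQ)) = ps (inr j) / sQ ^+ 2 * y j ^+ 2.
      by field; exact: lt0r_neq0.
    by rewrite ler_wpM2r ?sqr_ge0// ler_pM2r ?invr_gt0 ?exprn_gt0// lerDl ltW.
  lra.
- rewrite mulr_suml; apply: eq_bigr => i _; rewrite mulr_suml.
  by apply: eq_bigr => j _; rewrite mulrAC.
Qed.

End Duality.

(** * Set systems and their products *)

Section SetSystems.
Variable R : realType.

Definition member (V : finType) (F : setsys V) := {A : {set V} | A \in F}.

Definition incidence (V : finType) (F : setsys V) (A : member F) (v : V) : R :=
  (v \in sval A)%:R.

Lemma card_member (V : finType) (F : setsys V) : #|{: member F}| = #|F|.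
Proof. by rewrite card_sig; apply: eq_card. Qed.

Lemma disc_le_cmax (V : finType) (F : setsys V) x : (disc F <= cmax F x)%N.
Proof. by rewrite /disc; case: arg_minP => // y _ /(_ x isT); rewrite leEnat. Qed.

Lemma csumE (V : finType) (x : {ffun V -> bool}) (B S : {set V}) :
  (csum x (B :&: S))%:~R =
  \sum_(v in S) (v \in B)%:R * (if x v then 1 else -1) :> R.
Proof.
rewrite /csum rmorph_sum/= big_mkcond [RHS]big_mkcond/=; apply: eq_bigr => v _.
rewrite finset.in_setI; case: (v \in B); case: (v \in S) => //=.
  by rewrite mul1r; case: (x v).
by rewrite mul0r.
Qed.

Lemma herdisc_hdisc_le (V : finType) (F : setsys V) :
  hdisc_le (@incidence V F) (herdisc F)%:R.
Proof.
move=> S; set G := Defs.restrict F S.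
pose x := [arg min_(x < [ffun=> true]) cmax G x]%O.
exists (fun v => if x v then 1 else -1); split.
  by move=> v; case: (x v); [left|right].
move=> [B BF]; rewrite /incidence /= -csumE -intr_norm -[`|_|]abszE -pmulrn ler_nat.
apply: (@leq_trans (disc G)).
  rewrite /disc -/x /cmax; apply: (leq_bigmax_cond (F := fun A => absz (csum x A))).
  by apply/imsetP; exists B.
exact: (leq_bigmax_cond (F := fun J => disc (Defs.restrict F J))).
Qed.

Lemma hdisc_le_herdisc (V : finType) (F : setsys V) (D : R) :
  0 <= D -> hdisc_le (@incidence V F) D -> (herdisc F)%:R <= D.
Proof.
move=> D0 FD.
have : (herdisc F <= Num.truncn D)%N.
  apply/bigmax_leqP => S _.
  have [x [x1 xle]] := FD S.
  apply: leq_trans (disc_le_cmax _ [ffun v => x v == 1]) _.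
  apply/bigmax_leqP => _ /imsetP[B BF ->].
  rewrite truncn_ge_nat// pmulrn abszE intr_norm csumE.
  have := xle (exist _ B BF); rewrite /incidence/=.
  rewrite (eq_bigr (fun v => (v \in B)%:R * (if [ffun v => x v == 1] v then 1 else -1)))//.
  move=> v _; rewrite ffunE; congr (_ * _).
  by case: (x1 v) => ->; rewrite ?eqxx//; case: eqP.
by rewrite -(ler_nat R) => /le_trans; apply; have /andP[] := truncn_itv D0.
Qed.

Lemma card_gt1_nonempty (V : finType) (F : setsys V) :
  (1 < #|F|)%N -> exists2 A, A \in F & exists v, v \in A.
Proof.
move=> /card_gt1P[A [B [AF BF AB]]].
have [A0|[v vA]] := set_0Vmem A; last by exists A => //; exists v.
have [B0|[v vB]] := set_0Vmem B; last by exists B => //; exists v.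
by move: AB; rewrite A0 B0 eqxx.
Qed.

(** Restrict to a single point of a nonempty member. *)
Lemma herdisc_ge1 (V : finType) (F : setsys V) :
  (1 < #|F|)%N -> 1 <= (herdisc F)%:R :> R.
Proof.
move=> /card_gt1_nonempty[A AF [v vA]].
have [x [x1 xle]] := herdisc_hdisc_le F (finset.set1 v).
have := xle (exist _ A AF); rewrite big_set1 /incidence /= vA mul1r.
by case: (x1 v) => ->; rewrite ?normrN normr1.
Qed.

(** Otherwise duality provides a witness strictly above the value that [witness_bound] allows. *)
Lemma incidence_factors (V : finType) (F : setsys V) : (1 < #|F|)%N ->
  factors (@incidence V F) (36 * (herdisc F)%:R * ln (#|F|%:R : R)).
Proof.
move=> F1; have D1 := herdisc_ge1 F1; have D0 := lt_le_trans ltr01 D1.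
have L0 := ln_nat_gt0 R F1.
have g0 : 0 < 36 * (herdisc F)%:R * ln (#|F|%:R : R) by rewrite !mulr_gt0.
have [//|[w gw wit]] := factors_or_witness (@incidence V F) g0.
have := witness_bound _ D0 (herdisc_hdisc_le F) wit.
by rewrite card_member => /(_ F1) /(lt_le_trans gw); rewrite ltxx.
Qed.

Lemma factors_herdisc (V : finType) (F : setsys V) (g : R) : (1 < #|F|)%N -> 0 < g ->
  factors (@incidence V F) g ->
  (herdisc F)%:R <= 14 * Num.sqrt (ln (#|F|%:R : R)) * g.
Proof.
move=> F1 g0 fg; apply: hdisc_le_herdisc.
  by rewrite !mulr_ge0// ?sqrtr_ge0// ltW.
by have := factors_hdisc_le g0 _ fg; rewrite card_member; apply.
Qed.

(** A factorization at this value would give herdisc F <= (14/15) herdisc F, impossible for a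
    positive number; hence 15 rather than 14. *)
Lemma incidence_witness (V : finType) (F : setsys V) : (1 < #|F|)%N ->
  exists2 w, (herdisc F)%:R / (15 * Num.sqrt (ln (#|F|%:R : R))) <= w &
    witness (@incidence V F) w.
Proof.
move=> F1; have D1 := herdisc_ge1 F1; have D0 := lt_le_trans ltr01 D1.
have L0 := ln_nat_gt0 R F1.
set q := Num.sqrt _; have q0 : 0 < q by rewrite sqrtr_gt0.
have g0 : 0 < (herdisc F)%:R / (15 * q) by rewrite divr_gt0// mulr_gt0.
have [fg|[w gw wit]] := factors_or_witness (@incidence V F) g0; last first.
  by exists w => //; exact: ltW.
have := factors_herdisc F1 g0 fg; rewrite -/q.
have -> : 14 * q * ((herdisc F)%:R / (15 * q)) = 14 / 15 * (herdisc F)%:R.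
  by field; exact: lt0r_neq0.
lra.
Qed.

End SetSystems.

(** * Incidence matrices of products and the two inequalities *)

Section ProductSystem.
Variables (R : realType) (t : nat) (V : 'I_t -> finType).
Variable F : forall i : 'I_t, setsys (V i).
Hypothesis t_gt0 : (0 < t)%N.
Hypothesis F_gt1 : forall i, (1 < #|F i|)%N.

Lemma mem_prodsys (S : {dffun forall i : 'I_t, {set V i}}) :
  (forall i, S i \in F i) -> box S \in prodsys F.
Proof.
by move=> SF; rewrite inE; apply/existsP; exists S; rewrite eqxx andbT; apply/forallP.
Qed.

Lemma prodsysP (A : {set prodT V}) : A \in prodsys F ->
  exists2 S : {dffun forall i : 'I_t, {set V i}}, forall i, S i \in F i & A = box S.
Proof.
by rewrite inE => /existsP[S /andP[/forallP SF /eqP AS]]; exists S.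
Qed.

Lemma box_incidence (S : {dffun forall i : 'I_t, {set V i}}) (x : prodT V) :
  (x \in box S)%:R = \prod_i (x i \in S i)%:R :> R.
Proof.
rewrite inE; have [/forallP xS|] := boolP [forall i, x i \in S i].
  by rewrite big1// => i _; rewrite xS.
by move=> /forallPn[i /negbTE xi]; rewrite (bigD1 i)//= xi mul0r.
Qed.

Lemma nonempty_members : exists (S : {dffun forall i : 'I_t, {set V i}}) (x : prodT V),
  forall i, S i \in F i /\ x i \in S i.
Proof.
have H i : exists Sx : {set V i} * V i, Sx.1 \in F i /\ Sx.2 \in Sx.1.
  by have [A AF [v vA]] := card_gt1_nonempty (F_gt1 i); exists (A, v).
exists (finfun (fun i => (sval (cid (H i))).1)), (finfun (fun i => (sval (cid (H i))).2)).
by move=> i; rewrite !ffunE; case: cid.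
Qed.

(** Vary one side and keep the others nonempty: a point of the fixed sides then tells the two boxes
    apart. *)
Lemma card_prodsys_gt1 : (1 < #|prodsys F|)%N.
Proof.
have [S [x Sx]] := nonempty_members.
pose s := Ordinal t_gt0.
have /card_gt1P[A [B [AF BF AB]]] := F_gt1 s.
pose upd (C : {set V s}) : {dffun forall i : 'I_t, {set V i}} :=
  finfun (@eqtype.dfwith _ _ S s C).
have updF C : C \in F s -> box (upd C) \in prodsys F.
  move=> CF; apply: mem_prodsys => i; rewrite ffunE.
  case: (eqVneq s i) => [<-|si]; first by rewrite eqtype.dfwith_in.
  by rewrite eqtype.dfwith_out//; have [] := Sx i.
apply/card_gt1P; exists (box (upd A)), (box (upd B)); split; [exact: updF|exact: updF|].
apply: contra_neq AB => eAB; apply/setP => v.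
pose y : prodT V := finfun (@eqtype.dfwith _ _ x s v).
have yE C : (y \in box (upd C)) = (v \in C).
  rewrite inE; apply/forallP/idP => [/(_ s)|vC i].
    by rewrite !ffunE !eqtype.dfwith_in.
  rewrite !ffunE; case: (eqVneq s i) => [<-|si]; first by rewrite !eqtype.dfwith_in.
  by rewrite !eqtype.dfwith_out//; have [] := Sx i.
by rewrite -!yE eAB.
Qed.

Lemma herdisc_prodsys_le :
  (herdisc (prodsys F))%:R <= 14 * Num.sqrt (ln (#|prodsys F|%:R : R)) *
    \prod_i (36 * (herdisc (F i))%:R * ln (#|F i|%:R : R)).
Proof.
apply: factors_herdisc; first exact: card_prodsys_gt1.
  apply: prodr_gt0 => i _; rewrite !mulr_gt0//.
    exact: lt_le_trans ltr01 (herdisc_ge1 R (F_gt1 i)).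
  exact: (ln_nat_gt0 R (F_gt1 i)).
have H (A : member (prodsys F)) : exists S : {dffun forall i : 'I_t, {set V i}},
    (forall i, S i \in F i) /\ sval A = box S.
  by case: A => A AF; have [S SF AS] := prodsysP AF; exists S.
(* A box with an empty side has several descriptions; any choice of sides serves. *)
pose S A := sval (cid (H A)).
have SF A i : S A i \in F i by rewrite /S; case: cid => B [].
have SE A : sval A = box (S A) by rewrite /S; case: cid => B [].
pose a i (A : member (prodsys F)) (x : prodT V) : R :=
  incidence R (exist _ (S A i) (SF A i) : member (F i)) (x i).
have -> : @incidence R _ (prodsys F) = (fun A x => \prod_i a i A x).
  by apply/funext => A; apply/funext => x; rewrite /incidence SE box_incidence.
apply: factors_prod => i.
exact: (factors_pullback (fun A => exist _ (S A i) (SF A i) : member (F i))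
  (fun x : prodT V => x i) (incidence_factors R (F_gt1 i))).
Qed.

Lemma herdisc_prodsys_ge :
  \prod_i ((herdisc (F i))%:R / (15 * Num.sqrt (ln (#|F i|%:R : R)))) <=
  36 * (herdisc (prodsys F))%:R * ln (#|prodsys F|%:R : R).
Proof.
have /choice[w wP] : forall i, exists w,
    (herdisc (F i))%:R / (15 * Num.sqrt (ln (#|F i|%:R : R))) <= w /\
    witness (@incidence R _ (F i)) w.
  by move=> i; have [w h1 h2] := incidence_witness R (F_gt1 i); exists w.
have [S [x Sx]] := nonempty_members.
have F1 := card_prodsys_gt1.
apply: (@le_trans _ _ (\prod_i w i)).
  by apply: ler_prod => i _; rewrite (wP i).1 andbT divr_ge0.
rewrite -card_member; apply: witness_bound.
- by rewrite card_member.
- exact: lt_le_trans ltr01 (herdisc_ge1 R F1).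
- exact: herdisc_hdisc_le.
pose S0 : {dffun forall i, {: member (F i)}} :=
  finfun (fun i => exist _ (S i) (Sx i).1 : member (F i)).
have := witness_prod S0 x (fun i => (wP i).2) (index_enum_uniq _).
pose vals (Y : {dffun forall i, {: member (F i)}}) :
  {dffun forall i : 'I_t, {set V i}} := finfun (fun i => sval (Y i)).
have vF Y : box (vals Y) \in prodsys F.
  by apply: mem_prodsys => i; rewrite ffunE; case: (Y i).
apply: (witness_push (f := fun Y => exist _ (box (vals Y)) (vF Y) : member (prodsys F))
  (h := id)).
move=> Y y; rewrite /incidence /= box_incidence; apply: eq_bigr => i _.
by rewrite ffunE.
Qed.

End ProductSystem.

Theorem theorem5p3 (R : realType) :
  exists C : R, 0 < C /\
  forall (t : nat) (V : 'I_t -> finType) (F : forall i : 'I_t, setsys (V i)),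
    (0 < t)%N ->
    (forall i, 1 < #|F i|)%N ->
    let D : R := \prod_(i < t) (herdisc (F i))%:R in
    let N : R := (#|prodsys F|)%:R in
    D / (C ^+ t * ln N * \prod_(i < t) Num.sqrt (ln (#|F i|%:R : R)))
      <= (herdisc (prodsys F))%:R
    /\ (herdisc (prodsys F))%:R
      <= D * C ^+ t * Num.sqrt (ln N) * \prod_(i < t) ln (#|F i|%:R : R).
Proof.
have C_gt0 : 0 < 540 :> R by rewrite ltr0n.
exists 540; split=> [|t V F t0 F1 D N]; first exact: C_gt0.
have lnF_gt0 i : 0 < ln (#|F i|%:R : R).
  exact: (ln_nat_gt0 R (F1 i)).
have lnN_gt0 : 0 < ln N.
  exact: (ln_nat_gt0 R (card_prodsys_gt1 t0 F1)).
(* Since t >= 1, the constant paid once for the product is absorbed into the t-th power. *)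
have pow_le (x y : R) : 1 <= x -> 0 <= y -> x * y ^+ t <= (x * y) ^+ t.
  move=> x1 y0; rewrite exprMn ler_wpM2r ?exprn_ge0//.
  by rewrite -[leLHS]expr1 ler_weXn2l.
have D0 : 0 <= D by apply: prodr_ge0 => i _; rewrite ler0n.
have h0 : 0 <= (herdisc (prodsys F))%:R :> R by rewrite ler0n.
set h := (herdisc (prodsys F))%:R in h0 *.
split.
- set P := \prod_i Num.sqrt _.
  have P0 : 0 < P by apply: prodr_gt0 => i _; rewrite sqrtr_gt0.
  have := herdisc_prodsys_ge R t0 F1; rewrite -/h -/N.
  rewrite big_split/= -/D prodfV big_split/= prodr_const card_ord -/P.
  rewrite ler_pdivrMr; last by rewrite mulr_gt0// exprn_gt0.
  move=> Dle; rewrite ler_pdivrMr; last first.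
    exact: mulr_gt0 (mulr_gt0 (exprn_gt0 _ C_gt0) lnN_gt0) P0.
  apply: le_trans Dle _.
  have -> : 36 * h * ln N * (15 ^+ t * P) = h * (36 * 15 ^+ t * ln N * P) by ring.
  rewrite ler_wpM2l// ler_pM2r// ler_pM2r//.
  have -> : (540 : R) = 36 * 15 by ring.
  by apply: pow_le; lra.
- apply: le_trans (herdisc_prodsys_le R t0 F1) _; rewrite -/N.
  rewrite !big_split/= -/D prodr_const card_ord.
  set P := \prod_i ln _; have P0 : 0 < P by apply: prodr_gt0.
  have -> : 14 * Num.sqrt (ln N) * (36 ^+ t * D * P) =
    14 * 36 ^+ t * (D * Num.sqrt (ln N) * P) by ring.
  have -> : D * 540 ^+ t * Num.sqrt (ln N) * P =
    540 ^+ t * (D * Num.sqrt (ln N) * P) by ring.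
  apply: ler_wpM2r; first by rewrite !mulr_ge0// ?sqrtr_ge0// ltW.
  apply: le_trans (pow_le 14 36 _ _) _; try lra.
  by apply: lerXn2r; rewrite ?nnegrE; lra.
Qed.
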